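(* Let $s\in(0,1)$. There exists a constant $c=c(n,s)>0$ such that the following holds. Let $E\subset\mathbb{R}^n$ be $s$-minimal in the open set $\Omega\subset\mathbb{R}^n$, $x\in\partial E$ and $B_r(x)\subset\Omega$. Then there exist balls $$B_{cr}(y_1)\subset E\cap B_r(x),\qquad B_{cr}(y_2)\subset\mathcal{C}E\cap B_r(x).$$
   Context: $\mathcal{C}E$ is the complement. For disjoint measurable $A,B$, $\mathcal{L}_s(A,B):=\int_A\int_B\frac{dx\,dy}{|x-y|^{n+s}}$, and $P_s(E,\Omega):=\mathcal{L}_s(E\cap\Omega,\mathcal{C}E)+\mathcal{L}_s(E\setminus\Omega,\mathcal{C}E\cap\Omega)$. $E$ is $s$-minimal in $\Omega$ if $P_s(E,\Omega)<\infty$ and $P_s(E,\Omega)\le P_s(F,\Omega)$ for every measurable $F$ with $F\setminus\Omega=E\setminus\Omega$. Standing convention: every set $E$ is modified on a null set so that $E_1\subset E$ and $E\cap E_0=\emptyset$, where $E_1=\{x:\exists r>0,\ |E\cap B_r(x)|=\omega_nr^n\}$ and $E_0=\{x:\exists r>0,\ |E\cap B_r(x)|=0\}$, and so that $\partial E=\{x: 0<|E\cap B_r(x)|<\omega_nr^n\ \forall r>0\}$; $\omega_n=|B_1|$. *)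

(* Defs.v *)
From HB Require Import structures.
From mathcomp Require Import all_boot all_order all_algebra.
From mathcomp Require Import all_classical all_reals all_analysis.

Set Implicit Arguments.
Unset Strict Implicit.
Unset Printing Implicit Defensive.

Import Order.TTheory GRing.Theory Num.Theory.
Import numFieldNormedType.Exports.

Local Open Scope classical_set_scope.
Local Open Scope ring_scope.

(* [R^n] with [n >= 1] is ['rV[R]_n.+1]: in every definition below the
   dimension of the space is [n.+1].  The norm [`|x|] of the library on
   matrices is the sup norm (it induces the usual topology), hence the separate
   Euclidean norm and Euclidean balls. *)

Definition enorm (R : realType) (n : nat) (x : 'rV[R]_n.+1) : R :=
  Num.sqrt (\sum_(i < n.+1) x ord0 i ^+ 2).

Definition eball (R : realType) (n : nat) (x : 'rV[R]_n.+1) (r : R) :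
    set 'rV[R]_n.+1 :=
  [set y | enorm (y - x) < r].

Definition boundary (T : topologicalType) (A : set T) : set T :=
  closure A `\` interior A.

Section lebesgue_outer_measure.
Local Open Scope ereal_scope.
Variables (R : realType) (n : nat).
Local Notation V := 'rV[R]_n.+1.

Definition box (a b : V) : set V :=
  [set x | forall i, (a ord0 i < x ord0 i <= b ord0 i)%R].

(* Equal to 0 when [box a b] is empty. *)
Definition box_volume (a b : V) : R :=
  (\prod_(i < n.+1) Num.max (b ord0 i - a ord0 i) 0)%R.

Definition box_cover (X : set V) : set (nat -> V * V) :=
  [set F | X `<=` \bigcup_k box (F k).1 (F k).2].

Definition lebesgue_outer (X : set V) : \bar R :=
  ereal_inf [set \sum_(k <oo) (box_volume (F k).1 (F k).2)%:E
            | F in box_cover X].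

Let vol (p : V * V) : \bar R := (box_volume p.1 p.2)%:E.

Let vol_ge0 p : 0 <= vol p.
Proof. by rewrite lee_fin; apply: prodr_ge0 => i _; rewrite le_max lexx orbT. Qed.

Let vol0 : vol (0%R, 0%R) = 0.
Proof.
by rewrite /vol /box_volume big_ord_recl /= subrr maxxx mul0r.
Qed.

Lemma lebesgue_outer_ge0 X : 0 <= lebesgue_outer X.
Proof.
by apply: le_ereal_inf_tmp => _ [F _ <-]; apply: nneseries_ge0 => k *; exact: vol_ge0.
Qed.

Lemma lebesgue_outer0 : lebesgue_outer set0 = 0.
Proof.
apply/eqP; rewrite eq_le lebesgue_outer_ge0 andbT.
apply: ereal_inf_lbound; exists (fun=> (0%R, 0%R)); first by [].
by apply: eseries0 => k _ _; exact: vol0.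
Qed.

Lemma le_lebesgue_outer :
  {homo lebesgue_outer : A B / A `<=` B >-> A <= B}.
Proof.
move=> A B AB; apply/ereal_inf_le_tmp => _ [F BF <-].
by exists F => //; exact: subset_trans AB BF.
Qed.

Lemma lebesgue_outer_sigma_subadditive : sigma_subadditive lebesgue_outer.
Proof.
move=> A; have [[i ioo]|] := pselect (exists i, lebesgue_outer (A i) = +oo).
  rewrite (eseries_pinfty _ _ ioo) ?leey// => k _.
  by rewrite -ltNye (lt_le_trans _ (lebesgue_outer_ge0 _)).
rewrite -forallNE => Aoo.
suff add2e (e : {posnum R}) : lebesgue_outer (\bigcup_n A n) <=
    \sum_(i <oo) lebesgue_outer (A i) + e%:num%:E.
  by apply/lee_addgt0Pr => _/posnumP[].
rewrite (le_trans _ (epsilon_trick _ _ _))//; last first.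
  by move=> k; exact: lebesgue_outer_ge0.
pose P k (F : nat -> V * V) := box_cover (A k) F /\
  \sum_(j <oo) vol (F j) <=
    lebesgue_outer (A k) + (e%:num / (2 ^ k.+1)%:R)%:E.
have [G PG] : {G : nat -> nat -> V * V & forall k, P k (G k)}.
  apply: (@choice _ _ P) => k; rewrite /P /lebesgue_outer.
  set S := (X in ereal_inf X); move infS : (ereal_inf S) => iS.
  case: iS infS => [r Sr|Soo|Soo].
  - have en1 : (0 < e%:num / (2 ^ k.+1)%:R)%R by [].
    have /(lb_ereal_inf_adherent en1) : ereal_inf S \is a fin_num by rewrite Sr.
    move=> [_ [F AF <-] FS].
    by exists F; split => //; rewrite -Sr; exact/ltW.
  - by have := Aoo k; rewrite /lebesgue_outer Soo.
  - suff : lbound S 0 by move/le_ereal_inf_tmp; rewrite Soo.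
    by move=> /= _ [F _ <-]; apply: nneseries_ge0 => j *; exact: vol_ge0.
have volG_ge0 x : 0 <= (vol \o uncurry G) x by exact: vol_ge0.
apply: (@le_trans _ _ (\esum_(i in setT) (vol \o uncurry G) i)).
  rewrite /lebesgue_outer; apply: ereal_inf_lbound => /=.
  have /card_esym/ppcard_eqP[f] := card_nat2.
  exists (uncurry G \o f).
    move=> t [i _ /(PG i).1 [j _ Gt]]; exists (f^-1%FUN (i, j)) => //=.
    by rewrite invK ?inE.
  rewrite -(esum_pred_image (vol \o uncurry G) _ xpredT) ?[fun=> _]set_true//.
  by rewrite image_eq.
rewrite (_ : esum _ _ = \sum_(i <oo) \sum_(j <oo) vol (G i j)); last first.
  pose J : nat -> set (nat * nat) := fun i => [set (i, j) | j in setT].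
  rewrite (_ : setT = \bigcup_k J k); last first.
    by rewrite predeqE => -[a b]; split => // _; exists a => //; exists b.
  rewrite esum_bigcupT /=; last 2 first.
    - apply/trivIsetP => i j _ _ ij.
      rewrite predeqE => -[k m] /=; split => //= -[] [_] _ [<-{k} _].
      by move=> [m' _] [] /esym/eqP; rewrite (negbTE ij).
    - by move=> /= km; exact: volG_ge0.
  rewrite -(image_id [set: nat]) -fun_true esum_pred_image//; last first.
    by move=> k _; apply: esum_ge0 => *; exact: volG_ge0.
  apply: eq_eseriesr => /= j _.
  rewrite -(esum_pred_image (vol \o uncurry G) (pair j) predT)//=; last first.
    by move=> ? ? _ _; exact: (@can_inj _ _ _ snd).
  by congr esum; rewrite predeqE => -[a b]; split; move=> [i _ <-]; exists i.
apply: lee_lim.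
- apply: is_cvg_nneseries => k *.
  by apply: nneseries_ge0 => m *; exact: vol_ge0.
- apply: is_cvg_nneseries => k *; apply: adde_ge0 => //.
  exact: lebesgue_outer_ge0.
- by near=> k; apply: lee_sum => i _; exact: (PG i).2.
Unshelve. all: by end_near. Qed.

HB.instance Definition _ := isOuterMeasure.Build R V lebesgue_outer
  lebesgue_outer0 lebesgue_outer_ge0 le_lebesgue_outer
  lebesgue_outer_sigma_subadditive.

End lebesgue_outer_measure.

(* ['rV[R]_n.+1] with the sigma-algebra of Lebesgue (that is, Caratheodory)
   measurable sets. *)
Notation lebesgueT R n := (caratheodory_type (@lebesgue_outer R n)).

Definition lebesgue_n (R : realType) (n : nat) : set (lebesgueT R n) -> \bar R :=
  @lebesgue_outer R n.
HB.instance Definition _ (R : realType) (n : nat) :=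
  isMeasure.Build _ _ _ (@lebesgue_n R n)
    (@caratheodory_measure0 _ _ (@lebesgue_outer R n))
    (@caratheodory_measure_ge0 _ _ (@lebesgue_outer R n))
    (@caratheodory_measure_sigma_additive _ _ (@lebesgue_outer R n)).

Arguments lebesgue_n {R n}.

Definition lebesgue_measurable (R : realType) (n : nat)
    (A : set 'rV[R]_n.+1) : Prop :=
  measurable (A : set (lebesgueT R n)).

Section fractional_perimeter.
Local Open Scope ereal_scope.
Variables (R : realType) (n : nat).
Local Notation V := 'rV[R]_n.+1.
Implicit Types A B E F Omega : set V.

(* Meant for disjoint [A] and [B]; the value of the integrand on the diagonal
   [x = y] is then irrelevant. *)
Definition interaction (s : R) A B : \bar R :=
  \int[lebesgue_n]_(x in (A : set (lebesgueT R n)))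
    \int[lebesgue_n]_(y in (B : set (lebesgueT R n)))
      (1 / (enorm ((x : V) - (y : V)) `^ (n.+1%:R + s)))%R%:E.

Definition fractional_perimeter (s : R) E Omega : \bar R :=
  interaction s (E `&` Omega) (~` E) +
  interaction s (E `\` Omega) (~` E `&` Omega).

Definition s_minimal (s : R) E Omega : Prop :=
  [/\ lebesgue_measurable E,
      fractional_perimeter s E Omega < +oo &
      forall F, lebesgue_measurable F -> F `\` Omega = E `\` Omega ->
        fractional_perimeter s E Omega <= fractional_perimeter s F Omega].

Definition ball_volume (r : R) : \bar R :=
  lebesgue_n (eball (0 : V) 1) * (r ^+ n.+1)%:E.

Definition measure_interior E : set V :=
  [set x | exists2 r : R, (0 < r)%R &
    lebesgue_n (E `&` eball x r) = ball_volume r].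

Definition measure_exterior E : set V :=
  [set x | exists2 r : R, (0 < r)%R & lebesgue_n (E `&` eball x r) = 0].

(* Convention on representatives: every measurable set can be modified on a null
   set so as to satisfy this.  The last clause follows from the first two. *)
Definition normalized E : Prop :=
  [/\ measure_interior E `<=` E,
      E `&` measure_exterior E = set0 &
      boundary E = [set x | forall r : R, (0 < r)%R ->
        0 < lebesgue_n (E `&` eball x r) < ball_volume r]].

End fractional_perimeter.

(* Main.v *)
From HB Require Import structures.
Require Import Defs.
From mathcomp Require Import all_boot all_order all_algebra.
From mathcomp Require Import all_classical all_reals all_analysis.
From mathcomp Require Import measurable_realfun ring lra.

Set Implicit Arguments.
Unset Strict Implicit.
Unset Printing Implicit Defensive.

Import Order.TTheory GRing.Theory Num.Theory.
Import numFieldNormedType.Exports.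

Local Open Scope classical_set_scope.
Local Open Scope ring_scope.

(* Put A = E `&` B_rho(x) with B_rho(x) in Omega.  Comparing E with E `\` A gives
   L(A, CE) <= L(A, E `\` A) <= L(A, C B_rho(x)).  Averaging over rho in ]a, b[,
   for some rho the right-hand side is at most C (b - a)^(-s) |E `&` B_b(x)|: the
   set of rho separating two points y and z has measure at most
   min(|y - z|, b - a), and the integral of min(|y - z|, h) / |y - z|^(n+s) in z
   is at most C h^(1-s).  On the other hand L(A, CA) >= c |A| r^(-s) as soon as
   |A| <= |B_r| / 2.  Iterating over radii decreasing from r to r/2 yields
   the density estimate |E `&` B_r(x)| >= c r^n whenever E has positive measure
   near x; the same holds for CE, which is s-minimal too.

   If E `&` B_r(x) contained no ball of radius delta r, each y in
   E `&` B_(r/2)(x) would be within delta r of a point of CE, so the density of CE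
   there would make the integral over CE of the kernel centered at y at least
   c (delta r)^(-s).  By the density of E this gives
   L(E `&` B_(r/2)(x), CE) >= c delta^(-s) r^(n-s), against the upper bound
   C r^(n-s) obtained as above; so delta cannot be small. *)

(** * Euclidean norm and Euclidean balls *)

Section euclidean_norm.
Variables (R : realType) (n : nat).
Local Notation V := 'rV[R]_n.+1.
Implicit Types (x y z : V) (r t : R).

Lemma enorm_ge0 x : 0 <= enorm x.
Proof. exact: sqrtr_ge0. Qed.

Lemma sqr_enorm x : enorm x ^+ 2 = \sum_(i < n.+1) x ord0 i ^+ 2.
Proof. by rewrite sqr_sqrtr// sumr_ge0// => i _; rewrite sqr_ge0. Qed.

Lemma enorm_scale r x : enorm (r *: x) = `|r| * enorm x.
Proof.
rewrite /enorm -sqrtr_sqr -sqrtrM ?sqr_ge0// mulr_sumr; congr Num.sqrt.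
by apply: eq_bigr => i _; rewrite mxE exprMn.
Qed.

Lemma enormN x : enorm (- x) = enorm x.
Proof. by rewrite -scaleN1r enorm_scale normrN1 mul1r. Qed.

Lemma enormC x y : enorm (x - y) = enorm (y - x).
Proof. by rewrite -opprB enormN. Qed.

Lemma enorm0 : enorm (0 : V) = 0.
Proof. by rewrite -(scale0r (0 : V)) enorm_scale normr0 mul0r. Qed.

Lemma ler_enorm_coord x i : `|x ord0 i| <= enorm x.
Proof.
rewrite /enorm -sqrtr_sqr ler_wsqrtr// (bigD1 i)//= lerDl sumr_ge0// => j _.
by rewrite sqr_ge0.
Qed.

Lemma enorm_eq0 x : (enorm x == 0) = (x == 0).
Proof.
apply/eqP/eqP => [x0|->]; last exact: enorm0.
apply/rowP => i; rewrite mxE; apply/eqP; rewrite -normr_le0 -x0.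
exact: ler_enorm_coord.
Qed.

(* Lagrange's identity: the difference of the two sides is
   [\sum_(i, j) (x i * y j - x j * y i) ^+ 2 / 2]. *)
Lemma cauchy_schwarz x y :
  (\sum_(i < n.+1) x ord0 i * y ord0 i) ^+ 2 <= enorm x ^+ 2 * enorm y ^+ 2.
Proof.
rewrite !sqr_enorm expr2 -subr_ge0.
set S := \sum_i _ ^+ 2; set T := \sum_i _ ^+ 2; set P := \sum_i _ * _.
have H : \sum_(i < n.+1) \sum_(j < n.+1)
    (x ord0 i * y ord0 j - x ord0 j * y ord0 i) ^+ 2 = 2 * (S * T - P * P).
  have -> : 2 * (S * T - P * P) = S * T + T * S - 2 * (P * P) by ring.
  have SE (f g : 'I_n.+1 -> R) : (\sum_i f i) * (\sum_i g i) =
      \sum_i \sum_j f i * g j.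
    by rewrite mulr_suml; apply: eq_bigr => i _; rewrite mulr_sumr.
  rewrite !SE mulr_sumr -big_split/= -sumrB; apply: eq_bigr => i _.
  rewrite mulr_sumr -big_split/= -sumrB; apply: eq_bigr => j _; ring.
have : 0 <= 2 * (S * T - P * P).
  by rewrite -H; do 2 (apply: sumr_ge0 => ? _); rewrite sqr_ge0.
by rewrite pmulr_rge0.
Qed.

Lemma ler_enormD x y : enorm (x + y) <= enorm x + enorm y.
Proof.
rewrite -(@ler_pXn2r _ 2)// ?nnegrE ?enorm_ge0 ?addr_ge0 ?enorm_ge0//.
have -> : enorm (x + y) ^+ 2 =
    enorm x ^+ 2 + enorm y ^+ 2 + 2 * \sum_(i < n.+1) x ord0 i * y ord0 i.
  rewrite !sqr_enorm mulr_sumr -!big_split/=; apply: eq_bigr => i _.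
  by rewrite mxE; ring.
have -> : (enorm x + enorm y) ^+ 2 =
    enorm x ^+ 2 + enorm y ^+ 2 + 2 * (enorm x * enorm y) by ring.
rewrite lerD2l ler_pM2l// (le_trans (ler_norm _))//.
rewrite -(@ler_pXn2r _ 2)// ?nnegrE ?mulr_ge0 ?enorm_ge0//.
by rewrite real_normK ?num_real// exprMn cauchy_schwarz.
Qed.

Lemma ler_enorm_trans z x y : enorm (x - y) <= enorm (x - z) + enorm (z - y).
Proof. by rewrite (le_trans _ (ler_enormD _ _))// addrA subrK. Qed.

Lemma sub_eball x y r t : enorm (x - y) + r <= t -> eball x r `<=` eball y t.
Proof.
move=> h z; rewrite /eball/= => zx.
rewrite (le_lt_trans (ler_enorm_trans x _ _))// (lt_le_trans _ h)//.
by rewrite addrC ltrD2l.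
Qed.

Lemma sub_eball_radius x r t : r <= t -> eball x r `<=` eball x t.
Proof. by move=> rt; apply: sub_eball; rewrite subrr enorm0 add0r. Qed.

End euclidean_norm.

(** * Lebesgue measure: measurable sets, scaling, volume of balls *)

Section lebesgue_measurable_sets.
Variables (R : realType) (n : nat).
Local Notation V := 'rV[R]_n.+1.
Local Notation VT := (lebesgueT R n).
Implicit Types (x y z a b : V) (r t c : R).

Lemma box_volume_ge0 a b : 0 <= box_volume a b.
Proof. by apply: prodr_ge0 => i _; rewrite le_max lexx orbT. Qed.

Definition set_coord a i c : V := \row_j (if j == i then c else a ord0 j).

(** Cuts the [i]-th side at [c]; the [min] and [max] keep the identity true when [c] lies outside
    that side or the box is empty. *)
Lemma box_volume_split a b i c :
  box_volume a (set_coord b i (Num.min (b ord0 i) c)) +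
  box_volume (set_coord a i (Num.max (a ord0 i) c)) b = box_volume a b.
Proof.
rewrite /box_volume (bigD1 i)//= [X in _ + X](bigD1 i)//= [RHS](bigD1 i)//=.
rewrite !mxE eqxx.
rewrite [X in _ * X + _](eq_bigr (fun j => Num.max (b ord0 j - a ord0 j) 0));
  last by move=> j /negbTE ji; rewrite !mxE ji.
rewrite [X in _ + _ * X](eq_bigr (fun j => Num.max (b ord0 j - a ord0 j) 0));
  last by move=> j /negbTE ji; rewrite !mxE ji.
rewrite -mulrDl; congr (_ * _); move: (a _ _) (b _ _) => u v.
by have [vc|vc] := leP v c; have [uc|uc] := leP u c; rewrite /Num.max;
  repeat case: ltP => ?; lra.
Qed.

(** Caratheodory criterion: the hyperplane cuts each box of a cover of [X] into two half-open boxes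
    of the same total volume, which yields covers of the two parts of [X]. *)
Lemma lebesgue_measurable_halfspace i c :
  lebesgue_measurable [set x : V | x ord0 i <= c].
Proof.
apply: le_caratheodory_measurable => X.
apply: le_ereal_inf_tmp => _ [F XF <-].
pose F1 k := ((F k).1, set_coord (F k).2 i (Num.min ((F k).2 ord0 i) c)).
pose F2 k := (set_coord (F k).1 i (Num.max ((F k).1 ord0 i) c), (F k).2).
have F10 k : (0 <= (box_volume (F1 k).1 (F1 k).2)%:E)%E.
  by rewrite lee_fin box_volume_ge0.
have F20 k : (0 <= (box_volume (F2 k).1 (F2 k).2)%:E)%E.
  by rewrite lee_fin box_volume_ge0.
rewrite (eq_eseriesr (g := fun k => ((box_volume (F1 k).1 (F1 k).2)%:E +
    (box_volume (F2 k).1 (F2 k).2)%:E)%E)); last first.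
  by move=> k _; rewrite -EFinD box_volume_split.
rewrite nneseriesD//.
apply: leeD; apply: ereal_inf_lbound.
  exists F1 => // x [/XF[k _ xF] /= xc]; exists k => //= j; rewrite mxE.
  by case: eqP => [->|_]; rewrite ?le_min ?xc ?andbT; exact: xF.
exists F2 => // x [/XF[k _ xF] /= /negP]; rewrite -ltNge => xc.
exists k => //= j; rewrite mxE.
by case: eqP => [->|_]; rewrite ?gt_max ?xc ?andbT; exact: xF.
Qed.

Lemma measurable_coord i : measurable_fun setT (fun x : VT => (x : V) ord0 i).
Proof.
apply: (measurability _ (RGenOInfty.measurableE R)) => //.
move=> /= _ [_ [c ->] <-]; rewrite setTI.
rewrite [X in measurable X](_ : _ = ~` [set x : V | x ord0 i <= c]).
  by apply: measurableC; exact: lebesgue_measurable_halfspace.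
apply/seteqP; split=> x /=; rewrite in_itv/= andbT ltNge; first by move=> /negP.
by move=> /negP.
Qed.

Lemma measurable_fun_enorm d (T : measurableType d) (f : T -> V) :
  (forall i, measurable_fun setT (fun u : T => f u ord0 i)) ->
  measurable_fun setT (fun u : T => enorm (f u)).
Proof.
move=> mf.
rewrite [X in measurable_fun _ X](_ : _ =
    fun u => (\sum_(i < n.+1) f u ord0 i ^+ 2) `^ 2^-1); last first.
  by apply/funext => u; rewrite powR12_sqrt// sumr_ge0// => i _; rewrite sqr_ge0.
apply: (@measurableT_comp _ _ _ _ _ _ (fun v : R => v `^ 2^-1)).
  exact: measurable_powR.
by apply: measurable_sum => i; exact: measurable_funX.
Qed.

Lemma measurable_enormB y : measurable_fun setT (fun x : VT => enorm ((x : V) - y)).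
Proof.
apply: measurable_fun_enorm => i.
under eq_fun do rewrite !mxE.
by apply: measurable_funD; [exact: measurable_coord|exact: measurable_cst].
Qed.

Lemma lebesgue_measurable_eball x r : lebesgue_measurable (eball x r).
Proof.
rewrite /lebesgue_measurable /eball.
have := measurable_enormB x measurableT (measurable_itv `]-oo, r[).
by rewrite setTI preimage_itvNyo.
Qed.

Lemma lebesgue_measurable_box a b : lebesgue_measurable (box a b).
Proof.
have -> : box a b = \bigcap_(i in [set: 'I_n.+1])
    (~` [set x | x ord0 i <= a ord0 i] `&` [set x | x ord0 i <= b ord0 i]).
  apply/seteqP; split => x xab.
    by move=> i _ /=; move: (xab i) => /andP[? ->]; split => //; apply/negP; rewrite -ltNge.
  by move=> i; have [/= /negP + ->] := xab i I; rewrite -ltNge => ->.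
apply: fin_bigcap_measurable => // i _.
apply: measurableI; last exact: lebesgue_measurable_halfspace.
by apply: measurableC; exact: lebesgue_measurable_halfspace.
Qed.

Lemma lebesgue_measurable_open (A : set V) : open A -> lebesgue_measurable A.
Proof.
move=> oA.
(* The union runs over all pairs of rational corners; the second factor is everything or empty
   according to whether the box lies in [A], so boxes that leave [A] drop out. *)
have -> : A = \bigcup_(p : 'rV[rat]_n.+1 * 'rV[rat]_n.+1)
    (box (map_mx ratr p.1) (map_mx ratr p.2) `&`
     [set _ | box (map_mx ratr p.1) (map_mx ratr p.2) `<=` A]).
  apply/seteqP; split => [x Ax|x [p _ [+ /=]]]; last by move=> /[swap] /[apply].
  have /nbhs_ballP[e /= e0 xeA] : nbhs x A by exact: open_nbhs_nbhs.
  have [p1 p1x] : {p1 : 'I_n.+1 -> rat &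
      forall i, ratr (p1 i) \in `](x ord0 i - e), (x ord0 i)[}.
    apply: (@choice _ _ (fun i q => ratr q \in `](x ord0 i - e), (x ord0 i)[)) => i.
    by apply: rat_in_itvoo; rewrite ltrBlDr ltrDl.
  have [p2 p2x] : {p2 : 'I_n.+1 -> rat &
      forall i, ratr (p2 i) \in `](x ord0 i), (x ord0 i + e)[}.
    apply: (@choice _ _ (fun i q => ratr q \in `](x ord0 i), (x ord0 i + e)[)) => i.
    by apply: rat_in_itvoo; rewrite ltrDl.
  exists (\row_i p1 i, \row_i p2 i) => //; split => [i|y /= yb].
    rewrite !mxE; have := p1x i; have := p2x i; rewrite !in_itv/=.
    by move=> /andP[/ltW -> _] /andP[_ ->].
  apply: xeA; split => // i j; rewrite ord1.
  have := yb j; rewrite !mxE; have := p1x j; have := p2x j; rewrite !in_itv/=.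
  move=> /andP[_ h1] /andP[h2 _] /andP[h3 h4].
  by rewrite /ball/= ltr_norml; apply/andP; split; lra.
apply: countable_bigcupT_measurable => // p.
have [h|h] := pselect (box (map_mx ratr p.1) (map_mx ratr p.2) `<=` A).
  rewrite (_ : [set _ | _] = setT) ?setIT; first exact: lebesgue_measurable_box.
  by apply/seteqP; split.
rewrite (_ : [set _ | _] = set0) ?setI0//.
by apply/seteqP; split.
Qed.

Lemma lebesgue_box_le a b : (lebesgue_n (box a b) <= (box_volume a b)%:E)%E.
Proof.
apply: ereal_inf_lbound.
exists (fun k => if k == 0%N then (a, b) else (0, 0)).
  by move=> x xab; exists 0%N.
rewrite (nneseriesD1 (n := 0%N))//=; last first.
  by move=> k _; rewrite lee_fin; case: ifP => _; exact: box_volume_ge0.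
rewrite eseries0 ?adde0// => k _ /negbTE/= ->.
by rewrite /box_volume big_ord_recl/= subrr maxxx mul0r.
Qed.

(** The map [y |-> a + r *: y] sends a cover of [Y] to a cover of [X] and multiplies volumes by
    [r ^+ n.+1]. Applied to a dilation and to its inverse, the inequality becomes an equality for
    balls. *)
Lemma lebesgue_affine_le (X Y : set V) a r : 0 < r ->
  (forall x, X x -> Y (r^-1 *: (x - a))) ->
  (lebesgue_n X <= lebesgue_n Y * (r ^+ n.+1)%:E)%E.
Proof.
move=> r0 XY; rewrite -lee_pdivrMr ?exprn_gt0//.
apply: le_ereal_inf_tmp => _ [F YF <-].
rewrite lee_pdivrMr ?exprn_gt0//.
pose G k := (a + r *: (F k).1, a + r *: (F k).2).
apply: (@le_trans _ _ (\sum_(k <oo) (box_volume (G k).1 (G k).2)%:E)%E).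
  apply: ereal_inf_lbound; exists G => // x /XY/YF[k _ xF]; exists k => // i.
  have := xF i; rewrite !mxE => /andP[h1 h2].
  by rewrite -ltrBrDl -lerBlDl -ltr_pdivlMl// -ler_pdivrMl// h1 h2.
rewrite muleC -nneseriesZl//; last by move=> k _; rewrite lee_fin box_volume_ge0.
apply: lee_nneseries => k _; first by rewrite lee_fin box_volume_ge0.
rewrite -EFinM lee_fin /box_volume -[X in _ ^+ X]card_ord -prodr_const -big_split/=.
apply: ler_prod => i _; rewrite le_max lexx orbT/= !mxE.
rewrite maxr_pMr; last exact: ltW.
by rewrite mulr0 [a _ _ + _]addrC addrKA mulrBr.
Qed.

Lemma lebesgue_eball x r : 0 < r -> lebesgue_n (eball x r) = ball_volume n r.
Proof.
move=> r0; apply/eqP; rewrite eq_le /ball_volume; apply/andP; split.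
  apply: (@lebesgue_affine_le _ _ x) => // y; rewrite /eball/= subr0 enorm_scale => h.
  by rewrite ger0_norm ?invr_ge0 ?ltW// ltr_pdivrMl// mulr1.
rewrite -lee_pdivlMr ?exprn_gt0// -exprVn.
apply: (@lebesgue_affine_le _ _ (- r^-1 *: x)); first by rewrite invr_gt0.
move=> y; rewrite /eball/= subr0 => h.
rewrite invrK scalerBr scaleNr scalerN opprK scalerA divff ?gt_eqF// scale1r addrK.
by rewrite enorm_scale gtr0_norm// -[ltRHS]mulr1 ltr_pM2l.
Qed.

Lemma lebesgue_eball_fin x r : (lebesgue_n (eball x r) < +oo)%E.
Proof.
pose o := const_mx r : V.
apply: (@le_lt_trans _ _ (lebesgue_n (box (x - o) (x + o)))); last first.
  exact: le_lt_trans (lebesgue_box_le _ _) (ltry _).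
apply: le_lebesgue_outer => y; rewrite /eball/= => yxr i.
have := le_lt_trans (ler_enorm_coord _ i) yxr.
rewrite !mxE ltr_norml => /andP[h1 h2]; apply/andP; split; lra.
Qed.

(** This is what Tonelli's theorem asks of the measure. *)
Lemma lebesgue_n_sigma_finite : sigma_finite setT (@lebesgue_n R n).
Proof.
exists (fun k => eball (0 : V) k%:R).
  apply/seteqP; split => // x _; exists (Num.truncn (enorm x)).+1 => //.
  rewrite /eball/= subr0; exact: truncnS_gt.
move=> k; split; first exact: lebesgue_measurable_eball.
exact: lebesgue_eball_fin.
Qed.

HB.instance Definition _ := Measure_isSigmaFinite.Build _ _ _ (@lebesgue_n R n)
  lebesgue_n_sigma_finite.

End lebesgue_measurable_sets.

(** * Interactions: Tonelli, additivity, comparison of minimal sets *)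

Section interaction_theory.
Variables (R : realType) (n : nat) (s : R).
Local Notation V := 'rV[R]_n.+1.
Local Notation VT := (lebesgueT R n).
Local Notation leb := (@lebesgue_n R n).
Implicit Types (x y z : V) (r t : R) (A B E F Omega : set V).

Definition kernel x y : R := 1 / (enorm (x - y) `^ (n.+1%:R + s)).

Lemma kernelE x y : kernel x y = enorm (x - y) `^ (- (n.+1%:R + s)).
Proof. by rewrite /kernel div1r powRN. Qed.

Lemma kernelC x y : kernel x y = kernel y x.
Proof. by rewrite /kernel enormC. Qed.

Lemma kernel_ge0 x y : 0 <= kernel x y.
Proof. by rewrite kernelE powR_ge0. Qed.

Lemma measurable_enormB2 :
  measurable_fun setT (fun p : VT * VT => enorm ((p.1 : V) - (p.2 : V))).
Proof.
apply: measurable_fun_enorm => i.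
under eq_fun do rewrite !mxE.
apply: measurable_funB.
  exact: (measurableT_comp (@measurable_coord R n i) measurable_fst).
exact: (measurableT_comp (@measurable_coord R n i) measurable_snd).
Qed.

Lemma measurable_kernel2 :
  measurable_fun setT (fun p : VT * VT => (kernel p.1 p.2)%:E).
Proof.
apply/measurable_EFinP; under eq_fun do rewrite kernelE.
apply: (@measurableT_comp _ _ _ _ _ _ (fun v : R => v `^ (- (n.+1%:R + s)))).
  exact: measurable_powR.
exact: measurable_enormB2.
Qed.

Lemma measurable_kernel x : measurable_fun setT (fun y : VT => (kernel x y)%:E).
Proof.
exact: (measurableT_comp measurable_kernel2 (measurable_pair1 (x : VT))).
Qed.

Lemma interactionE A B : interaction s A B =
  (\int[leb]_(x in (A : set VT)) \int[leb]_(y in (B : set VT)) (kernel x y)%:E)%E.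
Proof. by []. Qed.

(** Tonelli. Symmetry, additivity and monotonicity of the interaction are then read off an integral
    over a product set. *)
Lemma interaction_prod A B : lebesgue_measurable A -> lebesgue_measurable B ->
  interaction s A B =
  (\int[leb \x leb]_(p in (A : set VT) `*` (B : set VT)) (kernel p.1 p.2)%:E)%E.
Proof.
move=> mA mB.
have mAB : measurable ((A : set VT) `*` (B : set VT)) by exact: measurableX.
rewrite [RHS]integral_mkcond fubini_tonelli1; last 2 first.
- by apply/(measurable_restrictT _ mAB); apply: measurable_funTS; exact: measurable_kernel2.
- by move=> p; rewrite patchE; case: ifP => // _; rewrite lee_fin kernel_ge0.
rewrite /interaction integral_mkcond; apply: eq_integral => x _.
rewrite patchE; case: ifPn => [/set_mem Ax|/negP xA].
  rewrite [LHS]integral_mkcond; apply: eq_integral => y _.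
  by rewrite !patchE in_setX/= [x \in A]mem_set.
rewrite /fubini_F; apply/esym/integral0_eq => y _; rewrite patchE in_setX/=.
by move/negP/negbTE : xA => ->.
Qed.

Lemma interaction_ge0 A B : (0 <= interaction s A B)%E.
Proof.
by apply: integral_ge0 => x _; apply: integral_ge0 => y _; rewrite lee_fin kernel_ge0.
Qed.

Lemma interactionC A B : lebesgue_measurable A -> lebesgue_measurable B ->
  interaction s A B = interaction s B A.
Proof.
move=> mA mB.
have mAB : measurable ((A : set VT) `*` (B : set VT)) by exact: measurableX.
rewrite interaction_prod// integral_mkcond fubini_tonelli2; last 2 first.
- by apply/(measurable_restrictT _ mAB); apply: measurable_funTS; exact: measurable_kernel2.
- by move=> p; rewrite patchE; case: ifP => // _; rewrite lee_fin kernel_ge0.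
rewrite interactionE [RHS]integral_mkcond; apply: eq_integral => y _.
rewrite patchE; case: ifPn => [/set_mem By|/negP yB].
  rewrite [RHS]integral_mkcond; apply: eq_integral => x _.
  by rewrite !patchE in_setX/= (mem_set By) andbT kernelC.
rewrite /fubini_G; apply/integral0_eq => x _; rewrite patchE in_setX/=.
by move/negP/negbTE : yB => ->; rewrite andbF.
Qed.

Lemma interactionUl A1 A2 B : lebesgue_measurable A1 -> lebesgue_measurable A2 ->
  lebesgue_measurable B -> A1 `&` A2 = set0 ->
  (interaction s (A1 `|` A2) B = interaction s A1 B + interaction s A2 B)%E.
Proof.
move=> m1 m2 mB A12; rewrite !interaction_prod//; last exact: measurableU.
have -> : ((A1 `|` A2 : set VT) `*` (B : set VT) = (A1 `*` B) `|` (A2 `*` B))%classic.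
  by apply/seteqP; split => [[x y] /= [[]]|[x y] /= []] => [*|*|[]|[]]; tauto.
rewrite ge0_integral_setU//; [exact: measurableX|exact: measurableX|..].
- by apply: measurable_funTS; exact: measurable_kernel2.
- by move=> p _; rewrite lee_fin kernel_ge0.
apply/disj_setPS => -[x y] /= [[A1x _] [A2x _]].
by have : (A1 `&` A2) x by []; rewrite A12.
Qed.

Lemma interactionUr A B1 B2 : lebesgue_measurable A -> lebesgue_measurable B1 ->
  lebesgue_measurable B2 -> B1 `&` B2 = set0 ->
  (interaction s A (B1 `|` B2) = interaction s A B1 + interaction s A B2)%E.
Proof.
move=> mA m1 m2 B12; rewrite (interactionC mA (measurableU _ _ m1 m2)).
by rewrite (interactionUl m1 m2 mA B12) (interactionC mA m1) (interactionC mA m2).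
Qed.

Lemma le_interaction A1 A2 B1 B2 :
  lebesgue_measurable A1 -> lebesgue_measurable A2 ->
  lebesgue_measurable B1 -> lebesgue_measurable B2 ->
  A1 `<=` A2 -> B1 `<=` B2 -> (interaction s A1 B1 <= interaction s A2 B2)%E.
Proof.
move=> mA1 mA2 mB1 mB2 A12 B12; rewrite !interaction_prod//.
apply: ge0_subset_integral; [exact: measurableX|exact: measurableX|..].
- by apply: measurable_funTS; exact: measurable_kernel2.
- by move=> p _; rewrite lee_fin kernel_ge0.
- by move=> [x y] [/= /A12 ? /B12].
Qed.

(** After splitting along [Omega], both sides are the sum of the same three interactions: inside
    with inside, and each inside part with the outside part of the other set. *)
Lemma fractional_perimeterC E Omega :
  lebesgue_measurable E -> lebesgue_measurable Omega ->
  fractional_perimeter s (~` E) Omega = fractional_perimeter s E Omega.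
Proof.
move=> mE mO; rewrite /fractional_perimeter setCK.
have mC : lebesgue_measurable (~` E) by exact: measurableC.
have m1 : lebesgue_measurable (E `&` Omega) by exact: measurableI.
have m2 : lebesgue_measurable (E `\` Omega) by exact: measurableD.
have m3 : lebesgue_measurable (~` E `&` Omega) by exact: measurableI.
have m4 : lebesgue_measurable (~` E `\` Omega) by exact: measurableD.
rewrite -[X in interaction s _ X + _ = _](setUIDK E Omega).
rewrite -[X in _ = interaction s _ X + _](setUIDK (~` E) Omega).
have d0 F : (F `&` Omega) `&` (F `\` Omega) = set0.
  by apply/seteqP; split => x //= [[_ ?] []].
rewrite (interactionUr m3 m1 m2 (d0 _)) (interactionUr m1 m3 m4 (d0 _)).
rewrite (interactionC m3 m1) (interactionC m3 m2) (interactionC m4 m1).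
exact: addeAC.
Qed.

(** The complement of a competitor is a competitor for [E] with the same perimeter. *)
Lemma s_minimalC E Omega : lebesgue_measurable Omega ->
  s_minimal s E Omega -> s_minimal s (~` E) Omega.
Proof.
move=> mO [mE PE minE]; split; [exact: measurableC|by rewrite fractional_perimeterC|].
move=> F mF FO; rewrite (fractional_perimeterC mE mO) -(fractional_perimeterC mF mO).
apply: minE; first exact: measurableC.
apply/seteqP; split => x /= [h xO]; split => //.
  apply: contrapT => Ex; have [] : (F `\` Omega) x by rewrite FO.
  by [].
by move=> Fx; have [] : (~` E `\` Omega) x by rewrite -FO.
Qed.

(* Test minimality against [E `\` A]. *)
Lemma s_minimal_interaction_le E Omega A : lebesgue_measurable Omega ->
  lebesgue_measurable A -> s_minimal s E Omega -> A `<=` E `&` Omega ->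
  (interaction s A (~` E) <= interaction s A (E `\` A))%E.
Proof.
move=> mO mA [mE PE minE] AEO.
have mC : lebesgue_measurable (~` E) by exact: measurableC.
have mEA : lebesgue_measurable (E `\` A) by exact: measurableD.
have m1 : lebesgue_measurable ((E `&` Omega) `\` A).
  by apply: measurableD => //; exact: measurableI.
have m2 : lebesgue_measurable (E `\` Omega) by exact: measurableD.
have m3 : lebesgue_measurable (~` E `&` Omega) by exact: measurableI.
have := minE _ mEA; move: PE; rewrite /fractional_perimeter.
have -> : (E `\` A) `&` Omega = (E `&` Omega) `\` A.
  by apply/seteqP; split => x /=; tauto.
have -> : (E `\` A) `\` Omega = E `\` Omega.
  by apply/seteqP; split => x /=; [tauto|move=> [? ?]; split => //; split => // /AEO[]].
have -> : ~` (E `\` A) = ~` E `|` A.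
  by rewrite setCD setUC.
have -> : (~` E `|` A) `&` Omega = (~` E `&` Omega) `|` A.
  apply/seteqP; split => x /=; first by tauto.
  by move=> [[? ?]|Ax]; [split => //; left|split; [right|have [] := AEO _ Ax]].
have e1 : interaction s (E `&` Omega) (~` E) =
    (interaction s A (~` E) + interaction s ((E `&` Omega) `\` A) (~` E))%E.
  by rewrite -(interactionUl mA m1 mC) ?setDIK// setDUK.
have d1 : ~` E `&` A = set0 by apply/seteqP; split => x //= [? /AEO[]].
have d2 : (~` E `&` Omega) `&` A = set0.
  by apply/seteqP; split => x //= [[? ?] /AEO[]].
have d3 : ((E `&` Omega) `\` A) `&` (E `\` Omega) = set0.
  by apply/seteqP; split => x //= [[[? ?] ?] []].
have e2 : interaction s A (E `\` A) =
    (interaction s ((E `&` Omega) `\` A) A + interaction s (E `\` Omega) A)%E.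
  rewrite (interactionC mA mEA) -(interactionUl m1 m2 mA d3).
  congr interaction; apply/seteqP; split => x /=.
    by move=> [Ex Ax]; have [Ox|Ox] := pselect (Omega x); [left|right].
  by move=> [|[Ex Ox]]; [tauto|split => // /AEO[]].
rewrite e1 e2 (interactionUr m1 mC mA d1) (interactionUr m2 m3 mA d2).
have := interaction_ge0 A (~` E).
have := interaction_ge0 ((E `&` Omega) `\` A) (~` E).
have := interaction_ge0 ((E `&` Omega) `\` A) A.
have := interaction_ge0 (E `\` Omega) A.
have := interaction_ge0 (E `\` Omega) (~` E `&` Omega).
move: (interaction s A _) (interaction s _ (~` E)) (interaction s _ (~` E `&` Omega)).
move: (interaction s _ A) (interaction s (E `\` Omega) A).
move=> p q a b d d0 q0 p0 b0 a0 fin /(_ erefl).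
(* Minimality now reads [a + b + d <= (b + p) + (d + q)] and the goal is [a <= p + q]. The terms [b]
   and [d] are part of the perimeter of [E], whose finiteness allows them to be cancelled. *)
have : (b + d \is a fin_num)%E.
  rewrite ge0_fin_numE ?adde_ge0//; apply: le_lt_trans fin.
  by rewrite -addeA leeDr.
move=> bd le; rewrite -(leeD2rE _ _ bd) addeA (le_trans le)//.
by rewrite addeACA addeC.
Qed.

End interaction_theory.

(** * Dyadic scales *)

Section powers_of_two.
Variable R : realType.
Implicit Types (d h a : R).

Lemma exp2_unbounded d : exists k, d < 2 ^+ k.
Proof.
exists (Num.truncn d).+1; rewrite (lt_le_trans (truncnS_gt _))// -natrX ler_nat.
exact/ltnW/ltn_expl.
Qed.

Lemma dyadic_far h d : 0 < h -> h <= d ->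
  exists j, 2 ^+ j * h <= d < 2 ^+ j.+1 * h.
Proof.
move=> h0 hd.
have Pex : exists k, d < 2 ^+ k * h.
  by have [k dk] := exp2_unbounded (d / h); exists k; rewrite -ltr_pdivrMr.
case: (ex_minnP Pex) => -[|j] dj jmin.
  by move: dj; rewrite expr0 mul1r ltNge hd.
exists j; rewrite dj andbT leNgt; apply/negP => /jmin.
by rewrite ltnn.
Qed.

Lemma dyadic_near h d : 0 < d -> d < h ->
  exists j, 2^-1 ^+ j.+1 * h <= d < 2^-1 ^+ j * h.
Proof.
move=> d0 dh.
have Pex : exists k, 2^-1 ^+ k.+1 * h <= d.
  have [k hk] := exp2_unbounded (h / d); exists k.
  rewrite exprVn mulrC ler_pdivrMr ?exprn_gt0// mulrC -ler_pdivrMr//.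
  by rewrite (le_trans (ltW hk))// ler_eXn2l// ltr1n.
case: (ex_minnP Pex) => -[|j] dj jmin; first by exists 0%N; rewrite dj expr0 mul1r.
exists j.+1; rewrite dj/= ltNge; apply/negP => /jmin.
by rewrite ltnn.
Qed.

(** Turns powers taken at dyadic scales into geometric sequences in [j], ready to be summed. *)
Lemma powR_geo c j h a : 0 <= c -> 0 <= h ->
  (c ^+ j * h) `^ a = (c `^ a) ^+ j * h `^ a.
Proof.
move=> c0 h0; rewrite powRM ?exprn_ge0//; congr (_ * _).
by rewrite -(powR_mulrn _ c0) -(powR_mulrn _ (powR_ge0 c a)); exact: powRAC.
Qed.

End powers_of_two.

(** * Upper bound for the integral of the truncated kernel *)

Section kernel_upper_bound.
Variables (R : realType) (n : nat) (s : R).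
Hypothesis hs : 0 < s < 1.
Local Notation V := 'rV[R]_n.+1.
Local Notation VT := (lebesgueT R n).
Local Notation leb := (@lebesgue_n R n).
Local Notation N := n.+1.
Implicit Types (x y z : V) (r t h : R) (A B E F Omega : set V).

(** Volume of the unit ball as a real number. Its positivity is assumed, or derived from a set of
    positive measure, wherever it matters. *)
Definition omega : R := fine (leb (eball (0 : V) 1)).

Lemma omega_ge0 : 0 <= omega.
Proof. exact: fine_ge0. Qed.

Lemma lebesgue_eballE x r : 0 < r -> leb (eball x r) = (omega * r ^+ N)%:E.
Proof.
move=> r0; rewrite lebesgue_eball// /ball_volume EFinM fineK//.
by rewrite ge0_fin_numE// lebesgue_eball_fin.
Qed.

Lemma kernel_powR x y : 0 < enorm (x - y) ->
  kernel s x y = (enorm (x - y) ^+ N)^-1 * enorm (x - y) `^ (- s).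
Proof.
move=> d0; rewrite kernelE opprD powRD ?(gt_eqF d0) ?implybT//.
by rewrite (powRN _ N%:R) powR_mulrn// enorm_ge0.
Qed.

(* With [d = enorm (x - y)], these bound [kernel s x y * Num.min d h] on the
   annuli [2 ^+ j * h <= d < 2 ^+ j.+1 * h] and
   [2^-1 ^+ j.+1 * h <= d < 2^-1 ^+ j * h] respectively. *)
Definition dyadic_bound h j : R :=
  (2 ^+ j * h) ^- N * (h * (2 ^+ j * h) `^ (- s)).

Definition dyadic_bound' h j : R :=
  (2^-1 ^+ j.+1 * h) ^- N * (2^-1 ^+ j * h) `^ (1 - s).

Lemma dyadic_bound_ge0 h j : 0 < h -> 0 <= dyadic_bound h j.
Proof.
by move=> /ltW h0; rewrite !mulr_ge0 ?powR_ge0// invr_ge0 exprn_ge0// mulr_ge0// exprn_ge0.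
Qed.

Lemma dyadic_bound'_ge0 h j : 0 < h -> 0 <= dyadic_bound' h j.
Proof.
move=> /ltW h0; rewrite mulr_ge0 ?powR_ge0// invr_ge0 exprn_ge0// mulr_ge0//.
Qed.

(** The factor [omega * 2 ^+ N] times the sums of two geometric series, the first over scales above
    [h], the second over scales below [h]. *)
Definition upper_const : R := omega * 2 ^+ N *
  ((1 - 2 `^ (- s))^-1 + (1 - 2^-1 `^ (1 - s))^-1).

(** Ratio of the series over large scales, which converges because [0 < s]. The ratio of the other
    series, bounded next, is less than 1 because [s < 1]. *)
Let sg1 : 0 < (2 : R) `^ (- s) < 1.
Proof.
have /andP[s0 _] := hs; rewrite powR_gt0//= powRN invf_lt1 ?powR_gt0//.
have : (1 : R) `^ s < 2 `^ s by apply: gt0_ltr_powR; rewrite ?nnegrE ?ltr1n.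
by rewrite powR1.
Qed.

Let ta1 : 0 < (2^-1 : R) `^ (1 - s) < 1.
Proof.
have /andP[_ s1] := hs; rewrite powR_gt0 ?invr_gt0//=.
have : (2^-1 : R) `^ (1 - s) < 1 `^ (1 - s).
  by apply: gt0_ltr_powR; rewrite ?nnegrE ?subr_gt0 ?invr_ge0// invf_lt1 ?ltr1n.
by rewrite powR1.
Qed.

Lemma upper_const_gt0 : 0 < omega -> 0 < upper_const.
Proof.
move=> w0; have /andP[_ h1] := sg1; have /andP[_ h2] := ta1.
by rewrite !mulr_gt0 ?exprn_gt0 ?addr_gt0 ?invr_gt0 ?subr_gt0.
Qed.

Lemma upper_const_ge0 : 0 <= upper_const.
Proof.
have /andP[_ /ltW h1] := sg1; have /andP[_ /ltW h2] := ta1.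
apply: mulr_ge0; first by rewrite mulr_ge0 ?omega_ge0// exprn_ge0.
by rewrite addr_ge0 ?invr_ge0 ?subr_ge0.
Qed.

(** Majorant of [kernel s x y * Num.min (enorm (x - y)) h] at scale [j]: each annulus is enlarged to
    the ball of its outer radius, whose volume is known. *)
Let bound h j y x : \bar R :=
  ((dyadic_bound h j * \1_(eball x (2 ^+ j.+1 * h)) y)%:E +
   (dyadic_bound' h j * \1_(eball x (2^-1 ^+ j * h)) y)%:E)%E.

Let bound_ge0 h j y x : 0 < h -> (0 <= bound h j y x)%E.
Proof.
move=> h0; rewrite /bound -EFinD lee_fin addr_ge0// mulr_ge0//.
  exact: dyadic_bound_ge0.
exact: dyadic_bound'_ge0.
Qed.

(** Each ball has twice the inner radius of its annulus, so its volume cancels the power [- N] of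
    that radius up to [omega * 2 ^+ N]; a geometric term remains. *)
Let integral_bound h j x : 0 < h ->
  (\int[leb]_y bound h j y x)%E = (omega * 2 ^+ N * h `^ (1 - s) *
    ((2 `^ (- s)) ^+ j + (2^-1 `^ (1 - s)) ^+ j))%:E.
Proof.
move=> h0; rewrite /bound.
have e0 k : 0 < 2^-1 ^+ k * h by rewrite mulr_gt0// exprn_gt0// invr_gt0.
have f0 k : 0 < 2 ^+ k * h by rewrite mulr_gt0// exprn_gt0.
have mb r : measurable (eball x r : set VT) by exact: lebesgue_measurable_eball.
have iE r : 0 < r -> (\int[leb]_y (\1_(eball x r) y)%:E = (omega * r ^+ N)%:E)%E.
  by move=> r0; rewrite integral_indic// setIT; exact: lebesgue_eballE.
under eq_integral do rewrite !EFinM.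
rewrite ge0_integralD; first last.
- by apply/measurable_EFinP; apply: measurable_funM => //; exact: measurable_indic.
- by move=> y _; rewrite -EFinM lee_fin mulr_ge0// dyadic_bound'_ge0.
- by apply/measurable_EFinP; apply: measurable_funM => //; exact: measurable_indic.
- by move=> y _; rewrite -EFinM lee_fin mulr_ge0// dyadic_bound_ge0.
- exact: measurableT.
have mi r : measurable_fun setT (fun y : VT => (\1_(eball x r) y : R)%:E).
  by apply/measurable_EFinP; exact: measurable_indic.
have kE k r : 0 <= k -> 0 < r ->
    (\int[leb]_y (k%:E * (\1_(eball x r) y)%:E) = k%:E * (omega * r ^+ N)%:E)%E.
  move=> k0 r0; rewrite ge0_integralZl_EFin ?iE//.
rewrite (kE _ _ (dyadic_bound_ge0 j h0))// (kE _ _ (dyadic_bound'_ge0 j h0))//.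
rewrite -!EFinM -EFinD; congr EFin.
rewrite /dyadic_bound /dyadic_bound' !powR_geo ?(ltW h0)//.
have hE : h `^ (1 - s) = h * h `^ (- s).
  by rewrite powRD ?(gt_eqF h0) ?implybT// powRr1// ltW.
rewrite mulrDr; congr (_ + _).
  have -> : 2 ^+ j.+1 * h = 2 * (2 ^+ j * h) by rewrite exprS mulrA.
  rewrite [(2 * _) ^+ N]exprMn hE.
  have : (2 ^+ j * h) ^+ N != 0 by rewrite gt_eqF// exprn_gt0.
  by move: ((2 ^+ j * h) ^+ N) (2 ^+ N) (h `^ (- s)) (2 `^ (- s) ^+ j) => u v p q u0; field.
have -> : 2^-1 ^+ j * h = 2 * (2^-1 ^+ j.+1 * h) by rewrite (exprS 2^-1 j); field.
rewrite [(2 * _) ^+ N]exprMn.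
have : (2^-1 ^+ j.+1 * h) ^+ N != 0 by rewrite gt_eqF// exprn_gt0.
by move: ((2^-1 ^+ j.+1 * h) ^+ N) (2 ^+ N) (h `^ _) (_ ^+ j) => u v p q u0; field.
Qed.

Let le_bound h x y : 0 < h ->
  ((kernel s x y * Num.min (enorm (x - y)) h)%:E <= \sum_(j <oo) bound h j y x)%E.
Proof.
move=> h0; have [s0 s1] := andP hs.
have [d0|d0] := ltP 0 (enorm (x - y)); last first.
  have -> : Num.min (enorm (x - y)) h = 0.
    have -> : enorm (x - y) = 0 by apply/eqP; rewrite eq_le d0 enorm_ge0.
    by rewrite min_l// ltW.
  rewrite mulr0; apply: nneseries_ge0 => j _ _; exact: bound_ge0.
(* All terms are nonnegative, so the one for the annulus around [x] that contains [y] suffices. *)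
suff [j hj] : exists j, ((kernel s x y * Num.min (enorm (x - y)) h)%:E <= bound h j y x)%E.
  rewrite (le_trans hj)// (nneseriesD1 (n := j))//; last first.
    by move=> k _; exact: bound_ge0.
  by rewrite leeDl// nneseries_ge0// => k _ _; exact: bound_ge0.
rewrite kernel_powR//.
have [dh|dh] := leP h (enorm (x - y)).
  have [j /andP[j1 j2]] := dyadic_far h0 dh.
  exists j; rewrite /bound -EFinD lee_fin.
  rewrite -[leLHS]addr0 lerD//.
    rewrite indicE mem_set; last by rewrite /eball/= enormC.
    rewrite mulr1 /dyadic_bound -mulrA (mulrC (_ `^ _) h).
    rewrite ler_pM ?invr_ge0 ?exprn_ge0 ?enorm_ge0 ?mulr_ge0 ?powR_ge0 ?(ltW h0)//.
      rewrite lef_pV2 ?posrE ?exprn_gt0 ?mulr_gt0 ?exprn_gt0//.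
      by rewrite lerXn2r// ?nnegrE ?mulr_ge0 ?exprn_ge0 ?enorm_ge0 ?ltW.
    rewrite ler_wpM2l ?(ltW h0)// !powRN lef_pV2 ?posrE ?powR_gt0 ?mulr_gt0 ?exprn_gt0//.
    apply: ge0_ler_powR => //.
    - by rewrite ltW.
    - by rewrite nnegrE mulr_ge0 ?exprn_ge0 ?(ltW h0).
    - by rewrite nnegrE enorm_ge0.
  by rewrite mulr_ge0 ?dyadic_bound'_ge0.
have [j /andP[j1 j2]] := dyadic_near d0 dh.
exists j; rewrite /bound -EFinD lee_fin.
rewrite -[leLHS]add0r lerD//.
  by rewrite mulr_ge0 ?dyadic_bound_ge0.
rewrite indicE mem_set; last by rewrite /eball/= enormC.
have e0 k : 0 < 2^-1 ^+ k * h by rewrite mulr_gt0// exprn_gt0// invr_gt0.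
rewrite mulr1 /dyadic_bound' -mulrA.
rewrite ler_pM ?invr_ge0 ?exprn_ge0 ?enorm_ge0 ?mulr_ge0 ?powR_ge0 ?enorm_ge0//.
  rewrite lef_pV2 ?posrE ?exprn_gt0//.
  by rewrite lerXn2r// ?nnegrE ?enorm_ge0 ?ltW.
rewrite mulrC -[X in X * _]powRr1 ?enorm_ge0//.
rewrite -powRD ?(gt_eqF d0) ?implybT//.
by apply: ge0_ler_powR; rewrite ?nnegrE ?enorm_ge0 ?subr_ge0 ?(ltW (e0 _)) ?(ltW j2) ?(ltW s1).
Qed.

Lemma measurable_kernel_min x h : measurable_fun setT
  (fun y : VT => (kernel s x (y : V) * Num.min (enorm (x - (y : V))) h)%:E).
Proof.
apply/measurable_EFinP; apply: measurable_funM.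
  by apply/measurable_EFinP; exact: measurable_kernel.
apply: measurable_minr; last exact: measurable_cst.
by under eq_fun do rewrite enormC; exact: measurable_enormB.
Qed.

Lemma integral_kernel_min x h : 0 < h ->
  (\int[leb]_y (kernel s x (y : V) * Num.min (enorm (x - (y : V))) h)%:E <=
   (upper_const * h `^ (1 - s))%:E)%E.
Proof.
move=> h0.
have mbound j : measurable_fun setT (fun y : VT => bound h j y x).
  have mb r : measurable (eball x r : set VT) by exact: lebesgue_measurable_eball.
  by apply: emeasurable_funD; apply/measurable_EFinP; apply: measurable_funM;
    [exact: measurable_cst|exact: measurable_indic|exact: measurable_cst|exact: measurable_indic].
apply: (@le_trans _ _ (\int[leb]_y \sum_(j <oo) bound h j y x)%E).
  apply: ge0_le_integral; first exact: measurableT.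
  - by move=> y _; rewrite lee_fin mulr_ge0 ?kernel_ge0// le_min enorm_ge0 ltW.
  - exact: measurable_kernel_min.
  - apply: (ge0_emeasurable_sum (P := xpredT)); last by [].
    by move=> j y _ _; exact: bound_ge0.
  - by move=> y _; exact: le_bound.
rewrite integral_nneseries//; last by move=> j y _; exact: bound_ge0.
rewrite (eq_eseriesr (fun j _ => integral_bound j x h0)).
apply: lime_le.
  apply: is_cvg_nneseries => j _ _; rewrite lee_fin.
  apply: mulr_ge0; first by rewrite !mulr_ge0 ?omega_ge0 ?exprn_ge0 ?powR_ge0.
  by rewrite addr_ge0// exprn_ge0// powR_ge0.
apply: nearW => k; rewrite sumEFin lee_fin -mulr_sumr /upper_const.
rewrite [leRHS]mulrAC ler_wpM2l ?mulr_ge0 ?omega_ge0 ?exprn_ge0 ?powR_ge0//.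
have geo (q : R) : 0 < q < 1 -> \sum_(0 <= i < k) q ^+ i <= (1 - q)^-1.
  move=> /andP[q0 q1]; have := @geometric_le_lim R k 1 q ler01 q0.
  rewrite mul1r ger0_norm ?(ltW q0)// => /(_ q1); rewrite /series/=.
  by under eq_bigr do rewrite mul1r.
by rewrite big_split/= lerD// geo.
Qed.

End kernel_upper_bound.

(** * Averaging over radii *)

Section good_radius.
Variables (R : realType) (n : nat) (s : R).
Hypothesis hs : 0 < s < 1.
Local Notation V := 'rV[R]_n.+1.
Local Notation VT := (lebesgueT R n).
Local Notation RT := (measurableTypeR R).
Local Notation leb := (@lebesgue_n R n).
Local Notation N := n.+1.
Variables (E : set V) (x0 : V) (a b : R).
Hypotheses (mE : lebesgue_measurable E) (ab : a < b).

(* [((rho, x), y)] with [x] in [E `&` eball x0 rho] and [y] outside [eball x0 rho]. *)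
Let D : set ((RT * VT) * VT) := [set p | [/\ a < p.1.1 < b, E p.1.2,
  enorm ((p.1.2 : V) - x0) < p.1.1 & p.1.1 <= enorm ((p.2 : V) - x0)]].

Let mrho : measurable_fun setT (fun p : (RT * VT) * VT => p.1.1 : R).
Proof. exact: (measurableT_comp measurable_fst measurable_fst). Qed.

Let mx : measurable_fun setT (fun p : (RT * VT) * VT => p.1.2 : VT).
Proof. exact: (measurableT_comp measurable_snd measurable_fst). Qed.

Let mnx : measurable_fun setT (fun p : (RT * VT) * VT => enorm ((p.1.2 : V) - x0)).
Proof. exact: (measurableT_comp (@measurable_enormB R n x0) mx). Qed.

Let mny : measurable_fun setT (fun p : (RT * VT) * VT => enorm ((p.2 : V) - x0)).
Proof. exact: (measurableT_comp (@measurable_enormB R n x0) measurable_snd). Qed.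

Let mD : measurable D.
Proof.
have -> : D = ((fun p : (RT * VT) * VT => a < (p.1.1 : R)) @^-1` [set true]) `&`
   ((fun p : (RT * VT) * VT => (p.1.1 : R) < b) @^-1` [set true]) `&`
   ((fun p : (RT * VT) * VT => p.1.2 : VT) @^-1` E) `&`
   ((fun p : (RT * VT) * VT => enorm ((p.1.2 : V) - x0) < p.1.1) @^-1` [set true]) `&`
   ((fun p : (RT * VT) * VT => (p.1.1 : R) <= enorm ((p.2 : V) - x0)) @^-1` [set true]).
  apply/seteqP; split => p; first by move=> [/andP[h1 h2] h3 h4 h5].
  by move=> [[[[h1 h2] h3] h4] h5]; split => //; apply/andP.
have mb (f : (RT * VT) * VT -> bool) : measurable_fun setT f ->
    measurable (f @^-1` [set true]).
  by move=> mf; rewrite -[_ @^-1` _]setTI; exact: mf.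
apply: measurableI; last by apply: mb; exact: measurable_fun_ler.
apply: measurableI; last by apply: mb; exact: measurable_fun_ltr.
apply: measurableI; last by rewrite -[_ @^-1` _]setTI; exact: mx.
apply: measurableI; apply: mb; exact: measurable_fun_ltr.
Qed.

Let G (p : (RT * VT) * VT) : \bar R := (kernel s p.1.2 p.2 * \1_D p)%:E.

Let G_ge0 p : (0 <= G p)%E.
Proof. by rewrite lee_fin mulr_ge0 ?kernel_ge0. Qed.

Let mG : measurable_fun setT G.
Proof.
apply/measurable_EFinP; apply: measurable_funM; last exact: measurable_indic.
apply/measurable_EFinP.
have m2 : measurable_fun setT (fun p : (RT * VT) * VT => (p.1.2 : VT, p.2 : VT)).
  by apply/measurable_fun_pairP; split => //; exact: measurable_snd.
exact: (measurableT_comp (@measurable_kernel2 R n s) m2).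
Qed.

(** Integrated in [x], this is the interaction across the sphere of radius [rho] ([phiE]);
    integrated in [rho], it is bounded uniformly in [x] ([inner]). *)
Let H (q : RT * VT) : \bar R := (\int[leb]_y G (q, y))%E.

Let H_ge0 q : (0 <= H q)%E.
Proof. exact: integral_ge0. Qed.

Let mH : measurable_fun setT H.
Proof. exact: (measurable_fun_fubini_tonelli_F _ mG). Qed.

Let phi (rho : R) := interaction s (E `&` eball x0 rho) (~` eball x0 rho).

Let phiE rho : a < rho < b -> (\int[leb]_x H (rho, x) = phi rho)%E.
Proof.
move=> rab; rewrite /phi interactionE [RHS]integral_mkcond.
apply: eq_integral => x _; rewrite patchE; case: ifPn => [/set_mem [Ex xr]|/negP xA].
  rewrite [RHS]integral_mkcond; apply: eq_integral => y _.
  rewrite patchE /G indicE /=; case: ifPn => [/set_mem/= /negP|/negP yB].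
    by rewrite -leNgt => yr; rewrite mem_set ?mulr1.
  rewrite memNset ?mulr0//= => -[_ _ _ yr]; apply: yB.
  by apply/mem_set => /=; apply/negP; rewrite -leNgt.
apply: integral0_eq => y _; rewrite /G indicE memNset ?mulr0//= => -[_ Ex xr _].
by apply: xA; apply/mem_set.
Qed.

(* For fixed [x] and [y] the admissible radii form an interval of length at most
   [Num.min (enorm (x - y)) (b - a)]. *)
Let inner x : (\int[lebesgue_measure]_rho H (rho, x) <=
   (upper_const n s * (b - a) `^ (1 - s))%:E * (\1_(E `&` eball x0 b) x)%:E)%E.
Proof.
have m2 : measurable_fun setT (fun q : RT * VT => ((q.1, x : VT), q.2)).
  apply/measurable_fun_pairP; split; last exact: measurable_snd.
  by apply/measurable_fun_pairP; split; [exact: measurable_fst|exact: measurable_cst].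
(* Tonelli in [rho] and [y]: for fixed [y], only the measure of the admissible radii has to be
   estimated. *)
rewrite [leLHS](_ : _ = \int[leb]_y \int[lebesgue_measure]_rho G ((rho, x), y))%E; last first.
  exact: (fubini_tonelli (m1 := lebesgue_measure) (m2 := leb)
    (fun q : RT * VT => G ((q.1, x), q.2)) (measurableT_comp mG m2)
    (fun q => G_ge0 _)).
pose e : R := \1_(E `&` eball x0 b) x.
have e0 : 0 <= e by [].
apply: (@le_trans _ _ (\int[leb]_y (e%:E * (kernel s x (y : V) *
    Num.min (enorm (x - (y : V))) (b - a))%:E))%E); last first.
  rewrite ge0_integralZl_EFin; [|exact: measurableT| |
    exact: measurable_kernel_min|by []]; last first.
    move=> y _; rewrite lee_fin mulr_ge0 ?kernel_ge0// le_min enorm_ge0 subr_ge0.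
    exact: ltW.
  rewrite muleC lee_wpmul2r ?lee_fin//.
  by apply: integral_kernel_min => //; rewrite subr_gt0.
have mk := @measurable_kernel_min R n s x (b - a).
apply: ge0_le_integral.
- exact: measurableT.
- by move=> y _; apply: integral_ge0.
- apply: (measurable_fun_fubini_tonelli_G (fun q : RT * VT => G ((q.1, x), q.2))).
    exact: measurableT_comp mG m2.
  by move=> q; exact: G_ge0.
- by apply: emeasurable_funM => //; exact: measurable_cst.
move=> y _.
(* Membership in [D] asks [rho] to exceed [a] and [enorm (x - x0)], to stay below [b], and to be at
   most [enorm (y - x0)]. *)
pose I := `]Num.max a (enorm (x - x0)), Num.min b (enorm ((y : V) - x0))].
have m3 : measurable_fun setT (fun rho : RT => ((rho, x : VT), y : VT)).
  apply: measurable_fun_pair; last exact: measurable_cst.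
  by apply: measurable_fun_pair; [exact: measurable_id|exact: measurable_cst].
have mI : measurable_fun setT (fun rho : RT => (\1_[set` I] rho : R)%:E).
  by apply/measurable_EFinP; exact: measurable_indic.
have c0 : 0 <= e * kernel s x y by rewrite mulr_ge0 ?kernel_ge0.
apply: (@le_trans _ _ (\int[lebesgue_measure]_rho
    ((e * kernel s x y)%:E * (\1_[set` I] rho)%:E))%E).
  apply: ge0_le_integral.
  - exact: measurableT.
  - by move=> rho _; exact: G_ge0.
  - exact: measurableT_comp mG m3.
  - by apply: emeasurable_funM => //; exact: measurable_cst.
  move=> rho _; rewrite /G -EFinM lee_fin -(mulrA e) (mulrCA e) ler_wpM2l ?kernel_ge0//=.
  have [Dp|Dp] := pselect (D ((rho, x), y)); last by rewrite indicE memNset// mulr_ge0.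
  have [/= /andP[h1 h2] h3 h4 h5] := Dp.
  have Ex : (E `&` eball x0 b) x by split => //; exact: lt_trans h4 h2.
  have Irho : [set` I] rho by rewrite /= in_itv/= gt_max le_min h1 h4 h5 ltW.
  by rewrite /e !indicE (mem_set Dp) (mem_set Ex) (mem_set Irho) mulr1.
have iI : (\int[lebesgue_measure]_rho (\1_[set` I] rho)%:E =
    lebesgue_measure ([set` I] : set R))%E.
  by rewrite integral_indic// setIT.
rewrite ge0_integralZl_EFin// iI lebesgue_measure_itv/=.
(* The triangle inequality bounds the length of [I] by [enorm (x - y)]. *)
have yx : enorm (y - x0) <= enorm (x - y) + enorm (x - x0).
  by rewrite [X in _ <= X + _]enormC ler_enorm_trans.
case: ifPn => [|_]; last first.
  rewrite mule0 -EFinM lee_fin; apply: mulr_ge0 => //.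
  by apply: mulr_ge0; rewrite ?kernel_ge0// le_min enorm_ge0 subr_ge0 ltW.
rewrite !lte_fin => mm; rewrite -EFinB -!EFinM lee_fin -(mulrA e).
rewrite ler_wpM2l// ler_wpM2l ?kernel_ge0//.
have [a1 a2] : a <= Num.max a (enorm (x - x0)) /\ enorm (x - x0) <= Num.max a (enorm (x - x0)).
  by rewrite !le_max !lexx orbT.
have [b1 b2] : Num.min b (enorm (y - x0)) <= b /\ Num.min b (enorm (y - x0)) <= enorm (y - x0).
  by rewrite !ge_min !lexx orbT.
by rewrite le_min; apply/andP; split; lra.
Qed.

(** If every [rho] violated the bound, integrating over []a, b[] would give at least twice the total
    that [inner] allows, the length [b - a] raising the exponent [- s] to [1 - s]. Positive measure
    makes the contradiction strict. *)
Lemma exists_good_radius : (0 < leb (E `&` eball x0 b))%E ->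
  exists2 rho, a < rho < b & (interaction s (E `&` eball x0 rho) (~` eball x0 rho) <=
    (2 * upper_const n s * (b - a) `^ (- s))%:E * leb (E `&` eball x0 b))%E.
Proof.
move=> v0.
have mEb : measurable (E `&` eball x0 b : set VT).
  by apply: measurableI => //; exact: lebesgue_measurable_eball.
have vfin : leb (E `&` eball x0 b) \is a fin_num.
  rewrite ge0_fin_numE//; apply: le_lt_trans (lebesgue_eball_fin x0 b).
  by apply: le_lebesgue_outer; exact: subIsetr.
have b0 : 0 < b.
  rewrite ltNge; apply/negP => b0; move: v0; rewrite (_ : _ `&` _ = set0) ?measure0 ?ltxx//.
  apply/seteqP; split => // y [_]; rewrite /eball/= ltNge.
  by rewrite (le_trans b0)// enorm_ge0.
have h0 : 0 < b - a by rewrite subr_gt0.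
move: vfin v0; set vE := leb _; move vEE : vE => [v| |]// _; rewrite lte_fin => v0.
(* A ball that contains a set of positive measure has positive volume. *)
have w0 : 0 < omega R n.
  have : (vE <= leb (eball x0 b))%E by apply: le_lebesgue_outer; exact: subIsetr.
  rewrite lebesgue_eballE// vEE lee_fin => /(lt_le_trans v0).
  by rewrite pmulr_lgt0// exprn_gt0.
have C0 := upper_const_gt0 hs w0.
apply: contrapT => /forall2NP nex.
have big rho : a < rho < b ->
    ((2 * upper_const n s * (b - a) `^ (- s))%:E * v%:E <= phi rho)%E.
  move=> rab; have [//|/negP] := nex rho.
  by rewrite -ltNge => /ltW.
pose F rho := (\int[leb]_x H (rho, x))%E.
have mF : measurable_fun setT F by exact: (measurable_fun_fubini_tonelli_F _ mH).
have : (\int[lebesgue_measure]_rho F rho <= (upper_const n s * (b - a) `^ (1 - s))%:E * v%:E)%E.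
  rewrite /F (fubini_tonelli (m1 := lebesgue_measure) (m2 := leb) H)//.
  apply: (@le_trans _ _ (\int[leb]_x ((upper_const n s * (b - a) `^ (1 - s))%:E *
      (\1_(E `&` eball x0 b) x)%:E))%E).
    apply: ge0_le_integral; [exact: measurableT| | | |by move=> x _; exact: inner].
    - by move=> x _; apply: integral_ge0.
    - exact: (measurable_fun_fubini_tonelli_G _ mH).
    - apply: emeasurable_funM; first exact: measurable_cst.
      by apply/measurable_EFinP; exact: measurable_indic.
  rewrite ge0_integralZl_EFin; [|exact: measurableT|by []| |].
  - by rewrite integral_indic// setIT -/vE -vEE.
  - by apply/measurable_EFinP; exact: measurable_indic.
  - by rewrite mulr_ge0 ?powR_ge0// ltW.
apply/negP; rewrite -ltNge.
apply: (@lt_le_trans _ _ ((2 * upper_const n s * (b - a) `^ (- s) * v)%:E * (b - a)%:E)%E).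
  rewrite -!EFinM lte_fin powRD ?(gt_eqF h0) ?implybT// powRr1 ?ltW//.
  have := powR_gt0 (- s) h0; move: (b - a) h0 (_ `^ _) => h h0 p p0.
  rewrite [ltRHS](_ : _ = 2 * (upper_const n s * (h * p) * v)); last by ring.
  by rewrite ltr_pMl ?ltr1n// mulr_gt0// mulr_gt0// mulr_gt0.
apply: (@le_trans _ _ (\int[lebesgue_measure]_(rho in `]a, b[) F rho)%E); last first.
  apply: ge0_subset_integral => //.
  by move=> rho _; apply: integral_ge0.
have -> : ((b - a)%:E = lebesgue_measure (`]a, b[ : set R))%E.
  by rewrite lebesgue_measure_itv/= lte_fin ab EFinB.
rewrite -integral_cst//.
apply: ge0_le_integral; first exact: measurable_itv.
- move=> rho _; rewrite lee_fin mulr_ge0 ?(ltW v0)// mulr_ge0 ?powR_ge0//.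
  by rewrite mulr_ge0// ltW.
- exact: measurable_cst.
- exact: measurable_funS mF.
- move=> rho /=; rewrite in_itv/= => rab; rewrite EFinM.
  by apply: le_trans (big _ rab) _; rewrite -(phiE rab).
Qed.

End good_radius.

(** * Density estimates and interior balls *)

Section density.
Variables (R : realType) (n : nat) (s : R).
Hypothesis hs : 0 < s < 1.
Local Notation V := 'rV[R]_n.+1.
Local Notation VT := (lebesgueT R n).
Local Notation leb := (@lebesgue_n R n).
Local Notation N := n.+1.
Local Notation omega := (omega R n).
Local Notation C := (upper_const n s).
Implicit Types (x y z w : V) (r t h a b : R) (A B E F Omega : set V).

Let s0 : 0 < s. Proof. by case/andP: hs. Qed.

(** The kernel decreases with the distance, so on the ball it is at least its value at distance [r].
    The hypothesis [~ B x] excludes [y = x], where division by zero makes the kernel 0. *)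
Lemma integral_kernel_ge B x r : lebesgue_measurable B -> ~ B x -> 0 < r ->
  ((r ^- N * r `^ (- s))%:E * leb (B `&` eball x r) <=
   \int[leb]_(y in (B : set VT)) (kernel s x y)%:E)%E.
Proof.
move=> mB Bx r0.
have mBr : measurable (B `&` eball x r : set VT).
  by apply: measurableI => //; exact: lebesgue_measurable_eball.
apply: (@le_trans _ _ (\int[leb]_(y in (B `&` eball x r : set VT)) (kernel s x y)%:E)%E).
  rewrite -(integral_cst leb mBr); apply: ge0_le_integral; first exact: mBr.
  - move=> y _; rewrite lee_fin mulr_ge0 ?powR_ge0// invr_ge0 exprn_ge0// ltW//.
  - exact: measurable_cst.
  - by apply: measurable_funTS; exact: measurable_kernel.
  move=> y [By]; rewrite /eball/= enormC => yr.
  have d0 : 0 < enorm (x - y).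
    rewrite lt_neqAle enorm_ge0 andbT eq_sym enorm_eq0 subr_eq0.
    by apply: contra_not_neq Bx => ->.
  rewrite lee_fin kernel_powR// ler_pM ?invr_ge0 ?exprn_ge0 ?powR_ge0 ?(ltW r0)//.
    rewrite lef_pV2 ?posrE ?exprn_gt0// lerXn2r ?nnegrE ?(ltW d0) ?(ltW r0)//.
    exact: ltW.
  rewrite !powRN lef_pV2 ?posrE ?powR_gt0//.
  by apply: ge0_ler_powR; rewrite ?nnegrE ?(ltW d0) ?(ltW r0) ?(ltW s0) ?(ltW yr).
apply: ge0_subset_integral; [exact: mBr|exact: mB|..|exact: subIsetl].
- by apply: measurable_funTS; exact: measurable_kernel.
- by move=> y _; rewrite lee_fin kernel_ge0.
Qed.

Lemma interaction_ge A B m : lebesgue_measurable A -> lebesgue_measurable B ->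
  0 <= m ->
  (forall x, A x -> (m%:E <= \int[leb]_(y in (B : set VT)) (kernel s x (y : V))%:E)%E) ->
  (m%:E * leb A <= interaction s A B)%E.
Proof.
move=> mA mB m0 h; rewrite interactionE -(integral_cst leb (mA : measurable (A : set VT))).
apply: ge0_le_integral.
- exact: mA.
- by move=> x _; rewrite lee_fin.
- exact: measurable_cst.
- apply: measurable_funTS.
  have mAB : measurable ([set: VT] `*` (B : set VT)) by exact: measurableX.
  have := measurable_fun_fubini_tonelli_F (m2 := leb)
    ((fun p : VT * VT => (kernel s p.1 p.2)%:E) \_ (setT `*` B)).
  have -> : fubini_F leb ((fun p : VT * VT => (kernel s p.1 p.2)%:E) \_ (setT `*` B)) =
      fun x : VT => (\int[leb]_(y in (B : set VT)) (kernel s x (y : V))%:E)%E.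
    apply/funext => x; rewrite /fubini_F [RHS]integral_mkcond.
    by apply: eq_integral => y _; rewrite !patchE in_setX in_setT.
  apply.
    by apply/(measurable_restrictT _ mAB); apply: measurable_funTS; exact: measurable_kernel2.
  by move=> p; rewrite patchE; case: ifP => // _; rewrite lee_fin kernel_ge0.
- by move=> x Ax; exact: h.
Qed.

Lemma lebesgue_setC_eball A x r : lebesgue_measurable A ->
  leb (eball x r) = (leb (A `&` eball x r) + leb (~` A `&` eball x r))%E.
Proof. by move=> mA; rewrite ![_ `&` eball x r]setIC; exact: mA. Qed.

(** For each [x] in [A], the set [A] fills at most half of [eball x r], so the complement fills at
    least half and [integral_kernel_ge] applies to it. *)
Lemma self_interaction_ge A r : lebesgue_measurable A -> 0 < r ->
  (leb A <= (omega / 2 * r ^+ N)%:E)%E ->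
  ((omega / 2 * r `^ (- s))%:E * leb A <= interaction s A (~` A))%E.
Proof.
move=> mA r0 Ar; have mC : lebesgue_measurable (~` A) by exact: measurableC.
apply: interaction_ge => //.
  by rewrite mulr_ge0 ?powR_ge0// divr_ge0// omega_ge0.
move=> x Ax; have nCx : ~ (~` A) x by exact.
apply: le_trans (integral_kernel_ge mC nCx r0).
have h : ((omega / 2 * r ^+ N)%:E <= leb (~` A `&` eball x r))%E.
  have Afin : leb (A `&` eball x r) \is a fin_num.
    by rewrite ge0_fin_numE//; apply: le_lt_trans (lebesgue_eball_fin x r);
      apply: le_lebesgue_outer; exact: subIsetr.
  rewrite -(leeD2lE _ _ Afin) -lebesgue_setC_eball// lebesgue_eballE//.
  have -> : (omega * r ^+ N)%:E = ((omega / 2 * r ^+ N)%:E + (omega / 2 * r ^+ N)%:E)%E.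
    by rewrite -EFinD; congr EFin; field.
  rewrite leeD2r// (le_trans _ Ar)//.
  by apply: le_lebesgue_outer; exact: subIsetl.
have rN0 : r ^+ N != 0 by rewrite gt_eqF// exprn_gt0.
rewrite (_ : omega / 2 * r `^ (- s) = r ^- N * r `^ (- s) * (omega / 2 * r ^+ N)); last by field.
by rewrite EFinM lee_wpmul2l// lee_fin mulr_ge0 ?powR_ge0// invr_ge0 exprn_ge0// ltW.
Qed.

(** The form in which minimality enters from here on: only the removal of a subset is tested. Asking
    it of [E] and of its complement covers removal and addition. *)
Definition one_sided_minimal E Omega := forall A, lebesgue_measurable A ->
  A `<=` E `&` Omega -> (interaction s A (~` E) <= interaction s A (E `\` A))%E.

(** What remains of [E] after removing its part in the ball lies outside the ball, so the good
    radius bounds its interaction with that part; minimality passes the bound to the complement of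
    [E]. The two bounds add up to the constant 4. *)
Lemma minimal_good_radius E Omega x a b :
  lebesgue_measurable E -> one_sided_minimal E Omega ->
  eball x b `<=` Omega -> a < b -> (0 < leb (E `&` eball x b))%E ->
  exists2 rho, a < rho < b &
    (interaction s (E `&` eball x rho) (~` E) <=
      (2 * C * (b - a) `^ (- s))%:E * leb (E `&` eball x b))%E /\
    (interaction s (E `&` eball x rho) (~` (E `&` eball x rho)) <=
      (4 * C * (b - a) `^ (- s))%:E * leb (E `&` eball x b))%E.
Proof.
move=> mE minE bO ab vb; have [rho rab hrho] := exists_good_radius hs mE ab vb.
exists rho; first exact: rab.
set A := E `&` eball x rho.
have mA : lebesgue_measurable A.
  by apply: measurableI => //; exact: lebesgue_measurable_eball.
have mC : lebesgue_measurable (~` E) by exact: measurableC.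
have mEA : lebesgue_measurable (E `\` A) by exact: measurableD.
have h1 : (interaction s A (E `\` A) <=
    (2 * C * (b - a) `^ (- s))%:E * leb (E `&` eball x b))%E.
  apply: le_trans hrho; apply: le_interaction => //.
    by apply: measurableC; exact: lebesgue_measurable_eball.
  by move=> y [Ey Ay] yB; apply: Ay.
have h2 : (interaction s A (~` E) <=
    (2 * C * (b - a) `^ (- s))%:E * leb (E `&` eball x b))%E.
  apply: le_trans h1; apply: minE => // y [Ey yB]; split => //; apply: bO.
  by apply: sub_eball_radius yB; case/andP: rab => _ /ltW.
split => //.
have -> : ~` A = ~` E `|` (E `\` A).
  apply/seteqP; split => y /=; last by move=> [Ey [/Ey]|[]].
  by move=> Ay; have [Ey|Ey] := pselect (E y); [right|left].
rewrite interactionUr//; last by apply/seteqP; split => y //= [Ey [/Ey]].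
apply: le_trans (leeD h2 h1) _; rewrite -ge0_muleDl.
- by rewrite -EFinD (_ : _ + _ = 4 * C * (b - a) `^ (- s))//; ring.
all: by rewrite lee_fin mulr_ge0 ?powR_ge0// mulr_ge0 ?upper_const_ge0.
Qed.

Lemma powR_small D : 0 < D -> exists2 t, 0 < t <= 1 & t `^ s <= D.
Proof.
move=> D0; exists (Num.min 1 (D `^ s^-1)); first by rewrite lt_min ltr01 powR_gt0//= ge_min lexx.
apply: (@le_trans _ _ ((D `^ s^-1) `^ s)).
  apply: ge0_ler_powR; rewrite ?nnegrE ?le_min ?ler01 ?powR_ge0 ?(ltW s0)//.
  by rewrite ge_min lexx orbT.
by rewrite -powRrM mulVf ?gt_eqF// powRr1// ltW.
Qed.

(* If [E] has less than the claimed measure in [eball x r], its measure in the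
   balls of radii [rad k], which decrease to [r / 2], decays like [2 ^- (k * N)],
   so that [E] is null in [eball x (r / 2)]. *)
Lemma density_estimate : 0 < omega -> exists2 c, 0 < c &
  forall E Omega x r, lebesgue_measurable E -> one_sided_minimal E Omega ->
    (forall t, 0 < t -> (0 < leb (E `&` eball x t))%E) ->
    0 < r -> eball x r `<=` Omega -> ((c * r ^+ N)%:E <= leb (E `&` eball x r))%E.
Proof.
move=> w0; have C0 := upper_const_gt0 hs w0.
(* Chosen so that one step of the iteration below gains the factor [2 ^- N]. *)
pose D := 2 ^- N * omega / (8 * C).
have D0 : 0 < D.
  apply: divr_gt0; last by apply: mulr_gt0.
  by apply: mulr_gt0 => //; rewrite invr_gt0 exprn_gt0.
have [t /andP[t0 t1] tD] := powR_small D0.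
(* With this [eta], [Rad k] below equals [t * (rad k - rad k.+1)], a small fraction of the gap
   between consecutive radii. *)
pose eta := t / 4.
have eta0 : 0 < eta by rewrite divr_gt0.
exists (omega / 2 * eta ^+ N); first by rewrite mulr_gt0 ?exprn_gt0// divr_gt0.
move=> E Omega x r mE minE Ex r0 rO; rewrite leNgt; apply/negP => small.
(* The radii [rad k] decrease from [r] to [r / 2]. By [claim], the part of [E] in [eball x (rad k)]
   has at most half the volume of a ball of radius [Rad k]. *)
pose rad k := r / 2 * (1 + 2^-1 ^+ k) : R.
pose Rad k := eta * r * 2^-1 ^+ k : R.
have q0 k : 0 < (2^-1 : R) ^+ k by rewrite exprn_gt0 ?invr_gt0.
have q1 k : (2^-1 : R) ^+ k <= 1 by rewrite exprn_ile1 ?invr_ge0// invf_le1// ler1n.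
have Rad0 k : 0 < Rad k by rewrite !mulr_gt0.
have claim k : (leb (E `&` eball x (rad k)) <= (omega / 2 * Rad k ^+ N)%:E)%E.
  elim: k => [|k IH].
    rewrite /rad /Rad expr0 mulr1 exprMn mulrA.
    have -> : r / 2 * (1 + 1) = r by field.
    exact: ltW.
  have radS : rad k - rad k.+1 = Rad k / t.
    by rewrite /rad /Rad /eta exprS; field; rewrite gt_eqF.
  have radk : rad k.+1 < rad k by rewrite -subr_gt0 radS divr_gt0.
  have radO : eball x (rad k) `<=` Omega.
    apply: subset_trans rO; apply: sub_eball_radius; rewrite /rad.
    by have := q1 k; nra.
  have v0 : (0 < leb (E `&` eball x (rad k)))%E.
    by apply: Ex; rewrite mulr_gt0 ?addr_gt0 ?divr_gt0.
  have [rho /andP[rho1 rho2] [_ le]] := minimal_good_radius mE minE radO radk v0.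
  have mA : lebesgue_measurable (E `&` eball x rho).
    by apply: measurableI => //; exact: lebesgue_measurable_eball.
  have Ak : (leb (E `&` eball x rho) <= (omega / 2 * Rad k ^+ N)%:E)%E.
    apply: le_trans IH; apply: le_lebesgue_outer; apply: setIS.
    by apply: sub_eball_radius; exact: ltW.
  (* The left side carries the measure of [E] at radius [rho], above [rad k.+1]; the right side
     carries it at [rad k], where [IH] applies. The ratio of the two scales leaves a power [s] of
     [t], at most [D]. *)
  have := le_trans (self_interaction_ge mA (Rad0 k) Ak) le.
  have P0 : 0 < Rad k `^ (- s) by rewrite powR_gt0.
  have -> : (rad k - rad k.+1) `^ (- s) = Rad k `^ (- s) * t `^ s.
    have -> : Rad k = t * (rad k - rad k.+1).
      by rewrite radS; field; rewrite gt_eqF.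
    rewrite powRM ?(ltW t0)//; last by rewrite subr_ge0 ltW.
    by rewrite mulrAC (powRN t) mulVf ?mul1r// gt_eqF// powR_gt0.
  move=> le1; have wP : 0 < omega / 2 * Rad k `^ (- s) by rewrite mulr_gt0// divr_gt0.
  apply: (@le_trans _ _ (leb (E `&` eball x rho))).
    by apply: le_lebesgue_outer; apply: setIS; apply: sub_eball_radius; exact: ltW.
  rewrite -(@lee_pmul2l _ (omega / 2 * Rad k `^ (- s))%:E)// ?lte_fin//.
  apply: (le_trans le1); have c0 : 0 <= 4 * C * (Rad k `^ (- s) * t `^ s).
    by apply: mulr_ge0; rewrite mulr_ge0 ?powR_ge0 ?(ltW C0).
  apply: (@le_trans _ _ ((4 * C * (Rad k `^ (- s) * t `^ s))%:E * (omega / 2 * Rad k ^+ N)%:E)%E).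
    by rewrite lee_wpmul2l ?lee_fin.
  rewrite -!EFinM lee_fin.
  have -> : Rad k.+1 = 2^-1 * Rad k by rewrite /Rad exprS mulrCA.
  rewrite [(2^-1 * _) ^+ N]exprMn [2^-1 ^+ N]exprVn.
  have M0 : 0 <= Rad k ^+ N by rewrite exprn_ge0 ?(ltW (Rad0 k)).
  have -> : omega / 2 * Rad k `^ (- s) * (omega / 2 * (2 ^- N * Rad k ^+ N)) =
      4 * C * (Rad k `^ (- s) * D) * (omega / 2 * Rad k ^+ N).
    have := exprn_gt0 N (ltr0n R 2); rewrite /D; move: (2 ^+ N) => X X0.
    by field; rewrite !gt_eqF.
  rewrite ler_wpM2r ?mulr_ge0 ?divr_ge0 ?(ltW w0)//.
  apply: ler_wpM2l; first by rewrite mulr_ge0 ?(ltW C0).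
  by apply: ler_wpM2l => //; exact: ltW.
have v0 : (0 < leb (E `&` eball x (r / 2)))%E by apply: Ex; rewrite divr_gt0.
(* Since [N >= 1], the bounds of [claim] are at most [M * 2^-1 ^+ k], which tends to 0 and
   contradicts [v0]. *)
pose M := omega / 2 * (eta * r) ^+ N.
have vM k : (leb (E `&` eball x (r / 2)) <= (M * 2^-1 ^+ k)%:E)%E.
  apply: (@le_trans _ _ (leb (E `&` eball x (rad k)))).
    apply: le_lebesgue_outer; apply: setIS; apply: sub_eball_radius.
    by rewrite /rad ler_peMr ?divr_ge0 ?(ltW r0)// lerDl ltW.
  apply: le_trans (claim k) _; rewrite lee_fin /M /Rad [(_ * 2^-1 ^+ k) ^+ N]exprMn mulrA.
  apply: ler_wpM2l.
    by rewrite mulr_ge0 ?divr_ge0 ?(ltW w0)// exprn_ge0// mulr_ge0 ?(ltW eta0) ?(ltW r0).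
  by rewrite exprS ler_piMr ?(ltW (q0 k))// exprn_ile1 ?(ltW (q0 k)).
move: v0; have := vM; case: (leb _) => [v| |] vM' //; last by have := vM' 0%N.
rewrite lte_fin => v0; have [k hk] := exp2_unbounded (M / v).
have := vM' k; rewrite lee_fin exprVn ler_pdivlMr ?exprn_gt0// mulrC leNgt.
by rewrite -ltr_pdivrMr// hk.
Qed.

(** Points of the complement close to every [y] in [E], with the density of the complement around
    them, make the interaction too large. These points are arbitrary, hence a positivity hypothesis
    at every point outside [E], whereas for [E] it is stated at [x]. *)
Lemma clean_ball : 0 < omega -> exists2 c, 0 < c &
  forall E Omega x r, lebesgue_measurable E ->
    one_sided_minimal E Omega -> one_sided_minimal (~` E) Omega ->
    (forall t, 0 < t -> (0 < leb (E `&` eball x t))%E) ->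
    (forall w t, ~ E w -> 0 < t -> (0 < leb (~` E `&` eball w t))%E) ->
    0 < r -> eball x r `<=` Omega ->
    exists y, eball y (c * r) `<=` E `&` eball x r.
Proof.
move=> w0; have C0 := upper_const_gt0 hs w0.
have [c c0 dens] := density_estimate w0.
(* Chosen so that the lower bound for the interaction is at least twice the upper bound. *)
pose D := c ^+ 2 * 4 ^- N / (4 * C * omega).
have D0 : 0 < D.
  apply: divr_gt0; last by apply: mulr_gt0 => //; exact: mulr_gt0.
  by apply: mulr_gt0; rewrite ?invr_gt0 exprn_gt0.
have [t /andP[t0 t1] tD] := powR_small D0.
exists (t / 4); first by rewrite divr_gt0.
move=> E Omega x r mE minE minC Ex Ew r0 rO; apply: contrapT => /forallNP noball.
have mC : lebesgue_measurable (~` E) by exact: measurableC.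
(* Radius of the balls assumed not to fit. As [d <= r / 4], two steps of length [d] from
   [eball x (r / 2)] stay in [eball x r]. *)
pose d := t / 4 * r; have d0 : 0 < d by rewrite mulr_gt0// divr_gt0.
have d4 : d <= r / 4 by rewrite /d; nra.
have r20 : 0 < r / 2 by rewrite divr_gt0.
have r2r : r / 2 < r by lra.
have [rho /andP[rho1 rho2] [le1 _]] := minimal_good_radius mE minE rO r2r (Ex _ r0).
have mB z u : lebesgue_measurable (E `&` eball z u).
  by apply: measurableI => //; exact: lebesgue_measurable_eball.
(* Lower bound for the kernel integral at [y]: the ball of radius [2 * d] around [y] contains a ball
   [eball w d] in which the complement has measure at least [c * d ^+ N]. *)
pose m := (2 * d) ^- N * (2 * d) `^ (- s) * (c * d ^+ N).
have m0' : 0 <= (2 * d) ^- N * (2 * d) `^ (- s).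
  by rewrite mulr_ge0 ?powR_ge0// invr_ge0 exprn_ge0// mulr_ge0 ?(ltW d0).
have m0 : 0 <= m.
  by rewrite mulr_ge0 ?m0'// mulr_ge0 ?(ltW c0)// exprn_ge0// ltW.
have low : (m%:E * leb (E `&` eball x (r / 2)) <= interaction s (E `&` eball x (r / 2)) (~` E))%E.
  apply: interaction_ge => // y [Ey yr].
  (* Otherwise [eball y d] would be one of the excluded balls. *)
  have [w wd nEw] : exists2 w, eball y d w & ~ E w.
    apply: contrapT => /forall2NP h; apply: (noball y) => w wd; split.
      by have [//|/contrapT] := h w.
    move: wd; apply: sub_eball; rewrite -/d; move: yr; rewrite /eball/=; lra.
  have nCy : ~ (~` E) y by exact.
  apply: le_trans (integral_kernel_ge mC nCy (mulr_gt0 (ltr0n _ 2) d0)).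
  rewrite /m EFinM lee_wpmul2l ?lee_fin ?m0'//.
  have dO : eball w d `<=` Omega.
    apply: subset_trans rO; apply: sub_eball; move: yr wd; rewrite /eball/= => yr wd.
    have := ler_enorm_trans y w x; lra.
  apply: le_trans (dens _ _ _ _ mC minC (fun u => Ew w u nEw) d0 dO) _.
  apply: le_lebesgue_outer; apply: setIS; apply: sub_eball.
  by move: wd; rewrite /eball/=; lra.
(* As [r / 2 < rho], the interaction of the smaller part of [E] is at most that of the part within
   radius [rho]. *)
have {low} : (m%:E * leb (E `&` eball x (r / 2)) <=
    (2 * C * (r - r / 2) `^ (- s))%:E * leb (E `&` eball x r))%E.
  apply: (le_trans low); apply: le_trans le1; apply: le_interaction => //.
  by apply: setIS; apply: sub_eball_radius; exact: ltW.
have r2O : eball x (r / 2) `<=` Omega.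
  by apply: subset_trans rO; apply: sub_eball_radius; exact: ltW.
have lowE := dens _ _ _ _ mE minE Ex r20 r2O.
have upE : (leb (E `&` eball x r) <= (omega * r ^+ N)%:E)%E.
  by rewrite -(lebesgue_eballE x)//; apply: le_lebesgue_outer; exact: subIsetr.
apply/negP; rewrite -ltNge.
apply: (@le_lt_trans _ _ ((2 * C * (r - r / 2) `^ (- s))%:E * (omega * r ^+ N)%:E)%E).
  by rewrite lee_wpmul2l// lee_fin mulr_ge0 ?powR_ge0// mulr_ge0 ?(ltW C0).
apply: (@lt_le_trans _ _ (m%:E * (c * (r / 2) ^+ N)%:E)%E); last by rewrite lee_wpmul2l.
rewrite -!EFinM lte_fin /m.
have -> : r - r / 2 = r / 2 by field.
have dE : 2 * d = t * (r / 2) by rewrite /d; field.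
have tE : (2 * d) `^ (- s) = (t `^ s)^-1 * (r / 2) `^ (- s).
  by rewrite dE (@powRM _ t (r / 2)) ?(ltW t0) ?(ltW r20)// -powRN.
have rE : r ^+ N = 2 ^+ N * (r / 2) ^+ N by rewrite -exprMn; congr (_ ^+ N); field.
(* The definition of [D], arranged to exhibit the spare factor 2 that makes the final inequality
   strict. *)
have D1 : c ^+ 2 * 2 ^- N = 2 * (D * (2 * C * omega * 2 ^+ N)).
  have e4 : (4 : R) ^+ N = 2 ^+ N * 2 ^+ N by rewrite -exprMn; congr (_ ^+ N); ring.
  rewrite /D e4; have := exprn_gt0 N (ltr0n R 2); move: (2 ^+ N) => X X0.
  by field; rewrite !gt_eqF.
have T0 : 0 < t `^ s by rewrite powR_gt0.
rewrite tE rE.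
have -> : (2 * d) ^- N * ((t `^ s)^-1 * (r / 2) `^ (- s)) * (c * d ^+ N) * (c * (r / 2) ^+ N)
  = (t `^ s)^-1 * (c ^+ 2 * 2 ^- N) * ((r / 2) `^ (- s) * (r / 2) ^+ N).
  have := exprn_gt0 N (ltr0n R 2); have := exprn_gt0 N d0.
  rewrite [(2 * d) ^+ N]exprMn; move: (d ^+ N) (2 ^+ N) => X Y X0 Y0.
  by field; rewrite !gt_eqF.
have -> : 2 * C * (r / 2) `^ (- s) * (omega * (2 ^+ N * (r / 2) ^+ N)) =
  2 * C * omega * 2 ^+ N * ((r / 2) `^ (- s) * (r / 2) ^+ N) by ring.
rewrite ltr_pM2r; last by rewrite mulr_gt0 ?powR_gt0// exprn_gt0.
rewrite ltr_pdivlMl// D1.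
have K0 : 0 < 2 * C * omega * 2 ^+ N.
  by apply: mulr_gt0; [apply: mulr_gt0 => //; apply: mulr_gt0|rewrite exprn_gt0].
apply: (@le_lt_trans _ _ (D * (2 * C * omega * 2 ^+ N))); first by rewrite ler_wpM2r// ltW.
by rewrite ltr_pMl ?ltr1n// mulr_gt0.
Qed.

End density.

(** * Conclusion for normalized minimal sets *)

(** Were the complement null in the ball, additivity would make [E] fill it. *)
Lemma lebesgue_setC_gt0 (R : realType) (n : nat) (E : set 'rV[R]_n.+1)
    (x : 'rV[R]_n.+1) (t : R) : lebesgue_measurable E -> 0 < t ->
  lebesgue_n (E `&` eball x t) != ball_volume n t ->
  (0 < lebesgue_n (~` E `&` eball x t))%E.
Proof.
move=> mE t0 h; rewrite lt_neqAle measure_ge0 andbT eq_sym.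
apply: contra h => /eqP h; rewrite -(lebesgue_eball x t0).
by rewrite (lebesgue_setC_eball x t mE) h adde0.
Qed.

Theorem corollary3p17 (R : realType) (n : nat) (s : R) (hs : 0 < s < 1) :
  exists2 c : R, 0 < c &
    forall (Omega E : set 'rV[R]_n.+1) (x : 'rV[R]_n.+1) (r : R),
      open Omega -> normalized E -> s_minimal s E Omega ->
      boundary E x -> 0 < r -> eball x r `<=` Omega ->
      (exists y1 : 'rV[R]_n.+1, eball y1 (c * r) `<=` E `&` eball x r) /\
      (exists y2 : 'rV[R]_n.+1, eball y2 (c * r) `<=` ~` E `&` eball x r).
Proof.
(* If the unit ball had no volume, the convention on [boundary E] would leave no boundary point, and
   any constant would serve. *)
have [w0|w0] := ltP 0 (omega R n); last first.
  exists 1 => // Omega E x r _ [_ _ bE] _ Ex; exfalso.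
  have /andP[+ _] : (0 < lebesgue_n (E `&` eball x 1) < ball_volume n 1)%E.
    by move: Ex; rewrite bE; apply.
  apply/negP; rewrite -leNgt; apply: (@le_trans _ _ (lebesgue_n (eball x 1))).
    by apply: le_lebesgue_outer; exact: subIsetr.
  by rewrite lebesgue_eballE// expr1n mulr1 lee_fin.
have [c c0 ball] := clean_ball hs w0; exists c => // Omega E x r oO [E1 E0 bE] sE Ex r0 rO.
have mO := lebesgue_measurable_open oO.
have mE : lebesgue_measurable E by case: sE.
have mC : lebesgue_measurable (~` E) by exact: measurableC.
have minE : one_sided_minimal s E Omega.
  by move=> A mA AE; exact: s_minimal_interaction_le sE AE.
have minC : one_sided_minimal s (~` E) Omega.
  by move=> A mA AE; exact: s_minimal_interaction_le (s_minimalC mO sE) AE.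
have Ex' t : 0 < t -> (0 < lebesgue_n (E `&` eball x t) < ball_volume n t)%E.
  by move: Ex; rewrite bE; apply.
(* A normalized [E] avoids its measure-theoretic exterior, so it has positive measure near each of
   its points; containing its measure-theoretic interior gives the same for the complement. *)
have inE w t : E w -> 0 < t -> (0 < lebesgue_n (E `&` eball w t))%E.
  move=> Ew t0; rewrite lt_neqAle measure_ge0 andbT; apply/eqP => h.
  have : (E `&` measure_exterior E) w by split => //; exists t.
  by rewrite E0.
have inC w t : ~ E w -> 0 < t -> (0 < lebesgue_n (~` E `&` eball w t))%E.
  move=> Ew t0; apply: lebesgue_setC_gt0 => //; apply/eqP => h.
  by apply: Ew; apply: E1; exists t.
split.
  by apply: (ball _ _ _ _ mE minE minC _ inC r0 rO) => t /Ex' /andP[].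
have minCC : one_sided_minimal s (~` ~` E) Omega by rewrite setCK.
(* The second ball comes from exchanging [E] and its complement; positivity near the points outside
   the complement is then [inE]. *)
apply: (ball _ _ _ _ mC minC minCC _ _ r0 rO).
  move=> t t0; apply: (lebesgue_setC_gt0 mE t0).
  by have /andP[_ /lt_eqF ->] := Ex' _ t0.
by move=> w t /contrapT Ew t0; rewrite setCK; exact: inE.
Qed.
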